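(* Let $n\ge2$, let $\lambda=(\lambda_1\ge\cdots\ge\lambda_{n-1}\ge0)$ be a partition, $\rho=(n-1,\ldots,1)$, $\mu=\lambda+\rho$, $m=\mu_1$, and let $\sigma$ be a semistandard Young tableau of shape $\mu$ with entries in $[n]$. Let $\widehat T=\widehat C_1\cdots\widehat C_m$ be its root filling. If for every $i=2,\ldots,m$ the pair $(\widehat C_{i-1},\widehat C_i)$ satisfies the Non-overlapping Condition, then \[ \sum_{T\in\mathrm{sort}^{-1}(\sigma)}(-1)^{\ell(T[1])}t^{\mathrm{inv}(T)}(1-t)^{\mathrm{des}(T)}=(-t)^{\sum_{i=2}^{m}(\check N(i)+\hat N(i))}(1-t)^{\sum_{i=2}^{m}p(i)}; \] otherwise the left-hand side equals $0$.
   Context: Young diagram of $\mu$: cells $(i,j)$, row $i$ from top, column $j$ from left; $\mu'_j$ is the length of column $j$; $r(u)=(i,j+1)$ for $u=(i,j)$ if it is a cell. Two cells attack if they lie in the same column, or are $(i,j)$ and $(k,j+1)$ with $i>k$. $F(\mu,n)$ is the set of fillings $T$ of $\mu$ with entries in $[n]$ such that attacking cells have distinct entries and $T(u)\le T(r(u))$ whenever $r(u)$ exists. $\mathrm{inv}(T)$ is the number of pairs of cells $(u,v)$ with $u=(j,k)$, $v=(i,k+1)$, $i<j$, such that $T(u)<T(v)<T(w)$ where $w=(j,k+1)$ if this cell exists, and $T(u)<T(v)$ otherwise; $\mathrm{des}(T)$ is the number of cells $u$ with $r(u)$ existing and $T(u)<T(r(u))$. $T[1]$ is the first column of $T$ (read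 top to bottom) and, for a sequence $C$, $\ell(C)$ is the number of pairs $i<j$ with $C(i)>C(j)$. $\mathrm{sort}^{-1}(\sigma)$ is the set of $T\in F(\mu,n)$ such that sorting every column of $T$ increasingly from top to bottom yields $\sigma$. Hat construction: given a column $C'=(C'(1),\ldots,C'(c'))$ of distinct integers and a set $S$ of size $c\in\{c',c'+1\}$, the column $\widehat C$ of length $c$ is built by placing every $x\in S\cap C'$ in the row where $x$ occurs in $C'$; if $c=c'+1$, placing the largest element of $S\setminus C'$ in row $c$; and placing the remaining elements of $S\setminus C'$, in decreasing order, in the rows occupied in $C'$ by the elements of $C'\setminus S$, in decreasing order. Root filling: $\widehat C_m$ is the last column of $\sigma$ (a single cell, since $\mu$ has distinct parts); for $i=m-1,\ldots,1$, $\widehat C_i$ is the hat construction applied to $S=$ the set of entries of column $i$ of $\sigma$ and $C'=\widehat C_{i+1}$ (column lengths of $\mu$ decrease by at most one, so the size condition holds). For a pair $(\widehat C,C')=(\widehat C_{i-1},\widehat C_i)$ with $c=|\widehat C|$, $c'=|C'|$: row $r$ is a pivot row if either $r\le c'$ and $\widehat C(r)<C'(r)$, or $r=c'+1\le c$; with pivot rows $q_1,\ldots,q_p$ put $b_j=\widehat C(q_j)$, $d_j=C'(q_j)$ if $q_j\le c'$ and $d_j=\infty$ otherwise. The pair satisfies the Non-overlapping Condition if $p\le1$ or the intervals $[b_j,d_j]$ ($[b_j,\infty)$ when $d_j=\infty$) are pairwise disjoint. Define $\check N(i)=\sum_{j=1}^p\#\{r>q_j:\ C'(r)\text{ is an entry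 of }\widehat C,\ b_j<C'(r)<d_j\}$, $\hat N(i)=\sum_{j=1}^p\#\{r<q_j:\ C'(r)\text{ is an entry of }\widehat C,\ b_j<C'(r)<d_j\}$, and $p(i)$ = number of rows $r\le c'$ with $\widehat C(r)<C'(r)$. $t$ is an indeterminate. *)

(* Defs.v *)
From mathcomp Require Import all_boot all_order all_algebra.
Set Implicit Arguments. Unset Strict Implicit. Unset Printing Implicit Defensive.
Import GRing.Theory.

Definition cell (mu : seq nat) (i j : nat) : bool :=
  (0 < i <= size mu) && (0 < j <= nth 0 mu i.-1).

Definition ncols (mu : seq nat) : nat := head 0 mu.

Definition colLen (mu : seq nat) (j : nat) : nat := count (fun r => j <= r) mu.

Definition rows (mu : seq nat) : seq nat := iota 1 (size mu).
Definition cols (mu : seq nat) : seq nat := iota 1 (ncols mu).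

Definition addrho (n : nat) (lam : seq nat) : seq nat :=
  [seq nth 0 lam i + (n.-1 - i) | i <- iota 0 n.-1].

Definition is_ssyt (n : nat) (mu : seq nat) (s : nat -> nat -> nat) : bool :=
  all (fun i => all (fun j => cell mu i j ==>
     [&& 1 <= s i j <= n,
         cell mu i j.+1 ==> (s i j <= s i j.+1) &
         cell mu i.+1 j ==> (s i j < s i.+1 j)]) (cols mu)) (rows mu).

Definition column (mu : seq nat) (F : nat -> nat -> nat) (j : nat) : seq nat :=
  [seq F i j | i <- iota 1 (colLen mu j)].

Definition inF (n : nat) (mu : seq nat) (F : nat -> nat -> nat) : bool :=
  all (fun i => all (fun j => all (fun k => all (fun l =>
     [&& cell mu i j ==> (1 <= F i j <= n),
         [&& cell mu i j, cell mu k l, l == j & i != k] ==> (F i j != F k l),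
         [&& cell mu i j, cell mu k l, l == j.+1 & k < i] ==> (F i j != F k l) &
         [&& cell mu i j, cell mu i j.+1, k == i & l == j.+1] ==> (F i j <= F k l)])
   (cols mu)) (rows mu)) (cols mu)) (rows mu).

Definition inv_stat (mu : seq nat) (F : nat -> nat -> nat) : nat :=
  \sum_(k <- cols mu) \sum_(j <- rows mu) \sum_(i <- rows mu)
    nat_of_bool [&& i < j, cell mu j k, cell mu i k.+1 &
      (if cell mu j k.+1 then (F j k < F i k.+1) && (F i k.+1 < F j k.+1)
       else F j k < F i k.+1)].

Definition des_stat (mu : seq nat) (F : nat -> nat -> nat) : nat :=
  \sum_(i <- rows mu) \sum_(j <- cols mu)
    nat_of_bool [&& cell mu i j, cell mu i j.+1 & F i j < F i j.+1].

Definition ell (C : seq nat) : nat :=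
  \sum_(i < size C) \sum_(j < size C)
    nat_of_bool ((i < j) && (nth 0 C j < nth 0 C i)).

(* A filling of mu is a finite function on the box [size mu] x [ncols mu];
   positions of the box outside mu must carry the dummy value 0. *)
Definition box (mu : seq nat) (n : nat) : finType :=
  {ffun 'I_(size mu) * 'I_(ncols mu) -> 'I_n.+1}.

Definition fv (mu : seq nat) (n : nat) (T : box mu n) (i j : nat) : nat :=
  if (0 < i) && (0 < j) then
    match (insub i.-1 : option 'I_(size mu)), (insub j.-1 : option 'I_(ncols mu)) with
    | Some a, Some b => nat_of_ord (T (a, b))
    | _, _ => 0
    end
  else 0.

Definition normalized (mu : seq nat) (n : nat) (T : box mu n) : bool :=
  [forall x : 'I_(size mu) * 'I_(ncols mu),
     ~~ cell mu x.1.+1 x.2.+1 ==> (nat_of_ord (T x) == 0)].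

Definition in_sort_inv (n : nat) (mu : seq nat) (s : nat -> nat -> nat)
    (T : box mu n) : bool :=
  [&& normalized T, inF n mu (fv T) &
      all (fun j => sort leq (column mu (fv T) j) == column mu s j) (cols mu)].

(* Cp = C' (distinct entries), S = set of entries (as a duplicate-free seq) *)
Definition hat (Cp S : seq nat) : seq nat :=
  let E := sort geq [seq x <- S | x \notin Cp] in
  let E' := if size S == (size Cp).+1 then behead E else E in
  let D := sort geq [seq x <- Cp | x \notin S] in
  [seq (if x \in S then x else nth 0 E' (index x D)) | x <- Cp]
  ++ (if size S == (size Cp).+1 then [:: head 0 E] else [::]).

(* root filling: rootcol_aux k = \hat C_{m-k} *)
Fixpoint rootcol_aux (mu : seq nat) (s : nat -> nat -> nat) (k : nat) : seq nat :=
  match k with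
  | 0 => column mu s (ncols mu)
  | k'.+1 => hat (rootcol_aux mu s k') (column mu s (ncols mu - k))
  end.

Definition rootcol (mu : seq nat) (s : nat -> nat -> nat) (i : nat) : seq nat :=
  rootcol_aux mu s (ncols mu - i).

(* Ch = \hat C (length c), Cp = C' (length c'); entries 1-indexed via nth _ (r-1) *)
Definition ent (C : seq nat) (r : nat) : nat := nth 0 C r.-1.

Definition is_pivot (Ch Cp : seq nat) (r : nat) : bool :=
  ((r <= size Cp) && (ent Ch r < ent Cp r)) || ((r == (size Cp).+1) && (r <= size Ch)).

Definition pivots (Ch Cp : seq nat) : seq nat :=
  [seq r <- iota 1 (size Ch) | is_pivot Ch Cp r].

(* d_j : None stands for infinity *)
Definition dval (Cp : seq nat) (q : nat) : option nat :=
  if q <= size Cp then Some (ent Cp q) else None.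

Definition le_inf (x : nat) (d : option nat) : bool :=
  if d is Some y then x <= y else true.
Definition lt_inf (x : nat) (d : option nat) : bool :=
  if d is Some y then x < y else true.

Definition overlap (b1 : nat) (d1 : option nat) (b2 : nat) (d2 : option nat) : bool :=
  le_inf b1 d2 && le_inf b2 d1.

Definition nonoverlap (Ch Cp : seq nat) : bool :=
  let P := pivots Ch Cp in
  (size P <= 1) ||
  all (fun a => all (fun b => (a != b) ==>
       ~~ overlap (ent Ch a) (dval Cp a) (ent Ch b) (dval Cp b)) P) P.

Definition Ncheck (Ch Cp : seq nat) : nat :=
  \sum_(q <- pivots Ch Cp) \sum_(r <- iota 1 (size Cp))
    nat_of_bool [&& q < r, ent Cp r \in Ch, ent Ch q < ent Cp r & lt_inf (ent Cp r) (dval Cp q)].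

Definition Nhat (Ch Cp : seq nat) : nat :=
  \sum_(q <- pivots Ch Cp) \sum_(r <- iota 1 (size Cp))
    nat_of_bool [&& r < q, ent Cp r \in Ch, ent Ch q < ent Cp r & lt_inf (ent Cp r) (dval Cp q)].

Definition pstat (Ch Cp : seq nat) : nat :=
  \sum_(r <- iota 1 (size Cp)) nat_of_bool (ent Ch r < ent Cp r).

(* Main.v *)
(* Given the column C' = T_(i+1), the signed sum over the orderings C of the entries of
   column i is a determinant: row r carries the weight of an entry placed to the left of
   C'(r), given the entries of C' above it. By row operations this determinant equals the
   one with rows (1 - t) [x < d] + [x = d], d in C', in which the order of C' only matters
   through the sign (-1)^l(C'). For sorted columns it evaluates to 0 or to a product over
   the intervals [b_j, d_j], which depend on the two sets of entries only. Hence the sum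
   over T telescopes column by column from the left, and its factors can be computed on
   the root filling. *)
Require Import Defs.
From mathcomp Require Import all_boot all_order all_algebra.
From mathcomp Require Import zify ring.
Set Implicit Arguments. Unset Strict Implicit. Unset Printing Implicit Defensive.
Import GRing.Theory.
Local Open Scope ring_scope.

(** A determinant needs as many rows as columns, but column [C] can be one cell longer than its
    right neighbour [C']. A virtual entry [B] above all others is therefore appended to [C']. It
    stands for infinity and costs one factor [1 - t] on both sides, which is cancelled at the end
    because the weights live in an integral domain where [1 - t] is nonzero. Violated filling
    conditions between two columns are encoded as weight zero, so that the sum can run over all
    orderings. The determinant is expressed through the increasing matching of the entries that are
    new in the left column with those that disappear. The hat column is the ordering of the left
    entries that puts the two members of every matched pair in the same row, so its pivot pairs are
    exactly the matched pairs. A common entry inside an interval is counted by one of [Ncheck] and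
    [Nhat], according to its row; only their sum matters, and the sum no longer sees the rows. *)

(** * Signed sums over orderings as determinants *)

Lemma ell_cons (x : nat) (C : seq nat) :
  ell (x :: C) = (count (fun y => y < x) C + ell C)%N.
Proof.
rewrite /ell /= big_ord_recl; congr addn.
  rewrite big_ord_recl /= add0n -sum1_count (big_nth 0%N) big_mkord [RHS]big_mkcond /=.
  by apply: eq_bigr => i _; rewrite add0n; case: ifP.
apply: eq_bigr => i _; rewrite big_ord_recl /= add0n.
by apply: eq_bigr => j _; rewrite /bump /= !add1n ltnS.
Qed.

Lemma sorted_ltn_count_rem (S : seq nat) (j : nat) :
  sorted ltn S -> (j < size S)%N ->
  count (fun y => y < nth 0 S j)%N (rem (nth 0%N S j) S) = j.
Proof.
move=> sS jS; have uS : uniq S by move: sS; rewrite ltn_sorted_uniq_leq => /andP[].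
rewrite count_rem mem_nth //= ltnn subn0.
rewrite -{2}(cat_take_drop j S) count_cat.
have -> : count (fun y => y < nth 0 S j)%N (drop j S) = 0%N.
  apply/eqP; rewrite -leqn0 leqNgt -has_count; apply/(has_nthP 0%N) => -[i].
  rewrite size_drop nth_drop => iS; apply/negP; rewrite -leqNgt.
  apply: (sorted_leq_nth leq_trans leqnn); rewrite ?inE; try lia.
  by move: sS; rewrite ltn_sorted_uniq_leq => /andP[].
rewrite addn0; apply/eqP; rewrite -[X in _ == X](size_takel (ltnW jS)) -all_count.
apply/(all_nthP 0%N) => i; rewrite size_takel ?(ltnW jS) // => ij.
rewrite nth_take //; apply: (sorted_ltn_nth ltn_trans) => //; rewrite ?inE; lia.
Qed.

Lemma nth_rem_nth (T : eqType) (x0 : T) (S : seq T) (j k : nat) :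
  uniq S -> (j < size S)%N -> nth x0 (rem (nth x0 S j) S) k = nth x0 S (bump j k).
Proof.
elim: S j k => //= x S IH [|j] k /andP[xS uS] jS; first by rewrite eqxx.
have -> : (x == nth x0 S j) = false.
  by apply: contraNF xS => /eqP ->; rewrite mem_nth.
by case: k => //= k; rewrite IH // /bump ltnS addnS.
Qed.

(* The number of elements of the sorted [S] below the first entry of [C] is the column
   index of that entry, so this is Laplace expansion along the first row. *)
Lemma signed_sum_permutations (R : comNzRingType) (N : nat) (f : nat -> nat -> R)
    (S : seq nat) :
  sorted ltn S -> size S = N ->
  \sum_(C <- permutations S) (-1) ^+ ell C * \prod_(i < N) f i (nth 0%N C i)
  = \det (\matrix_(i < N, j < N) f i (nth 0%N S j)).
Proof.
elim: N f S => [|N IH] f S sS zS.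
  by rewrite (size0nil zS) det_mx00 /= big_seq1 big_ord0 mulr1 /ell big_ord0.
have uS : uniq S by move: sS; rewrite ltn_sorted_uniq_leq => /andP[].
rewrite (perm_big _ (permutationsE _)) ?zS //= big_allpairs_dep undup_id //.
rewrite (big_nth 0%N) big_mkord zS (expand_det_row _ ord0).
apply: eq_bigr => j _; set x := nth 0%N S j.
have jS : (j < size S)%N by rewrite zS.
have srem : sorted ltn (rem x S) by apply: (subseq_sorted ltn_trans (rem_subseq _ _)).
have zrem : size (rem x S) = N by rewrite size_rem ?mem_nth // zS.
rewrite /cofactor mxE -/x.
transitivity (f 0%N x * ((-1) ^+ j * \sum_(t <- permutations (rem x S))
   (-1) ^+ ell t * \prod_(i < N) f i.+1 (nth 0%N t i))).
  rewrite !mulr_sumr big_seq [RHS]big_seq; apply: eq_bigr => t.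
  rewrite mem_permutations => /permP tp.
  rewrite ell_cons tp sorted_ltn_count_rem // big_ord_recl /= exprD.
  under eq_bigr do rewrite /bump /= add1n.
  by ring.
rewrite (IH (fun i => f i.+1)) //; congr (_ * (_ * \det _)).
apply/matrixP=> i k; rewrite !mxE /= /x nth_rem_nth //.
Qed.

Lemma sort_leq_ltn (C : seq nat) : uniq C -> sorted ltn (sort leq C).
Proof. by move=> uC; rewrite ltn_sorted_uniq_leq sort_uniq uC sort_sorted //; apply: leq_total. Qed.

(** The sign of the sorting permutation is obtained without naming that permutation: [(-1) ^+ ell C]
    is the determinant of the 0-1 matrix [P], because in [signed_sum_permutations] with indicator
    weights only the ordering [C] survives. Multiplication by [P] then rearranges the rows. *)
Lemma det_row_order (R : comNzRingType) (N : nat) (g : nat -> nat -> R) (C : seq nat) :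
  uniq C -> size C = N ->
  \det (\matrix_(i < N, j < N) g (nth 0%N C i) j)
  = (-1) ^+ ell C * \det (\matrix_(i < N, j < N) g (nth 0%N (sort leq C) i) j).
Proof.
move=> uC zC; set S := sort leq C.
have uS : uniq S by rewrite sort_uniq.
have zS : size S = N by rewrite size_sort.
pose P : 'M[R]_N := \matrix_(i, k) (nth 0%N C i == nth 0%N S k)%:R.
have -> : (-1) ^+ ell C = \det P.
  rewrite /P -(signed_sum_permutations (fun i x => (nth 0%N C i == x)%:R)) ?sort_leq_ltn //.
  rewrite (bigD1_seq C) ?permutations_uniq ?mem_permutations 1?perm_sym ?perm_sort //=.
  rewrite big1 ?mulr1; last by move=> i _; rewrite eqxx.
  rewrite big_seq_cond big1 ?addr0 // => D /andP[]; rewrite mem_permutations => pD nD.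
  have zD : size D = N by rewrite (perm_size pD).
  have [i ni] : exists i : 'I_N, nth 0%N C i != nth 0%N D i.
    apply/existsP; apply: contraNT nD; rewrite negb_exists => /forallP eqCD.
    apply/eqP/(@eq_from_nth _ 0%N); rewrite ?zD ?zC // => i iN.
    by have := eqCD (Ordinal iN); rewrite negbK => /eqP.
  by rewrite (bigD1 i) //= (negbTE ni) mul0r mulr0.
rewrite -det_mulmx; congr (\det _); apply/matrixP => i j; rewrite !mxE.
have iS : nth 0%N C i \in S by rewrite mem_sort mem_nth // zC.
have kN : (index (nth 0%N C i) S < N)%N by rewrite -[X in (_ < X)%N]zS index_mem.
rewrite (bigD1 (Ordinal kN)) //= !mxE /= nth_index // eqxx mul1r big1 ?addr0 // => k nk.
rewrite !mxE; case: eqP => [e|_]; last by rewrite mul0r.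
case/eqP: nk; apply/val_inj; rewrite /= e index_uniq ?zS //.
Qed.

(** * Weights of a single row *)

Section Weights.
Variables (R : comNzRingType) (t : R).

Definition gw (d x : nat) : R :=
  if x == d then 1 else if (x < d)%N then 1 - t else 0.

(* Weight of an entry [x] lying to the left of [d], when [e] lists the entries above
   [d] in the column of [d]; the value [0] records a violated filling condition. *)
Definition rw (e : seq nat) (d x : nat) : R :=
  if x == d then 1 else
  if (x < d)%N && (x \notin e) then (1 - t) * t ^+ count (fun y => x < y < d)%N e else 0.

Lemma rw_nil d x : rw [::] d x = gw d x.
Proof. by rewrite /rw /gw /= mulr1 andbT. Qed.

(** For [x < y < d] the interval from [x] to [d] splits at [y], and the identity reduces to
    [t = 1 - (1 - t)]. For [x = y < d] the two terms cancel, which is the attack condition coming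
    from [y]. *)
Lemma rw_cons (y : nat) (e : seq nat) (d x : nat) :
  y \notin e -> d \notin e -> d != y ->
  rw (y :: e) d x = rw e d x -
    (if (y < d)%N then (1 - t) * t ^+ count (fun z => y < z < d)%N e else 0) * rw e y x.
Proof.
move=> ye de dy; rewrite /rw /= inE negb_or.
have [->|xd] := eqVneq x d.
  rewrite (negbTE dy); case: ifP => yd; last by rewrite mul0r subr0.
  by rewrite ltnNge ltnW //= mulr0 subr0.
have [xe|xe] /= := boolP (x \in e).
  rewrite !andbF; case: eqP => [xy|_]; last by rewrite mulr0 subr0.
  by rewrite -xy xe in ye.
rewrite !andbT; have [->|xy] /= := eqVneq x y.
  by rewrite andbF mulr1; case: ifP; rewrite ?subrr ?subr0.
rewrite andbT; case: (ltngtP y d) => yd; last by rewrite yd eqxx in dy.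
  case: (ltngtP x y) xy => // xy _; last by rewrite /= mulr0 subr0 add0n.
  rewrite (ltn_trans xy yd) /=.
  have -> : count (fun z => x < z < d)%N e
    = (count (fun z => x < z < y) e + count (fun z => y < z < d) e)%N.
    elim: e ye {de xe} => //= z e IH; rewrite inE negb_or => /andP[yz ye].
    rewrite IH //; lia.
  by rewrite !exprD expr1; ring.
by rewrite mul0r subr0 andbF add0n.
Qed.

(* Row operations: up to multiples of the rows indexed by [e], the attack and
   inversion constraints coming from [e] disappear. *)
Lemma rw_span (e : seq nat) (d : nat) : uniq (d :: e) ->
  exists l : nat -> R, forall x, rw e d x = gw d x + \sum_(y <- e) l y * gw y x.
Proof.
elim: e d => [|y e IH] d.
  by exists (fun _ => 0) => x; rewrite big_nil addr0 rw_nil.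
rewrite /= inE negb_or => /andP[/andP[dy de] /andP[ye ue]].
have [ld Hd] : exists l : nat -> R, forall x, rw e d x = gw d x + \sum_(y <- e) l y * gw y x.
  by apply: IH; rewrite /= de.
have [ly Hy] : exists l : nat -> R, forall x, rw e y x = gw y x + \sum_(y <- e) l y * gw y x.
  by apply: IH; rewrite /= ye.
set c := if (y < d)%N then (1 - t) * t ^+ count (fun z => y < z < d)%N e else 0.
exists (fun z => if z == y then - c else ld z - c * ly z) => x.
rewrite rw_cons // -/c Hd Hy big_cons eqxx.
have -> : \sum_(z <- e) (if z == y then - c else ld z - c * ly z) * gw z x
   = \sum_(z <- e) ld z * gw z x - c * \sum_(z <- e) ly z * gw z x.
  rewrite mulr_sumr -sumrB big_seq [RHS]big_seq; apply: eq_bigr => z ze.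
  case: eqP => [zy|_]; first by rewrite -zy ze in ye.
  by ring.
by ring.
Qed.

(** The combinations in [rw_span] use only rows above the current one, so the passage from [gw] to
    [rw] is multiplication by a unitriangular matrix. *)
Lemma det_rw (N : nat) (C S : seq nat) : uniq C -> size C = N ->
  \det (\matrix_(i < N, j < N) rw (take i C) (nth 0%N C i) (nth 0%N S j))
  = \det (\matrix_(i < N, j < N) gw (nth 0%N C i) (nth 0%N S j)).
Proof.
move=> uC zC.
have /fin_all_exists [l Hl] : forall i : 'I_N, exists l : nat -> R, forall x,
    rw (take i C) (nth 0%N C i) x
    = gw (nth 0%N C i) x + \sum_(y <- take i C) l y * gw y x.
  move=> i; apply: rw_span.
  have : uniq (take i.+1 C) by rewrite take_uniq.
  by rewrite (take_nth 0%N) ?zC // rcons_uniq.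
pose L : 'M[R]_N := \matrix_(i, k)
  if (k < i)%N then l i (nth 0%N C k) else (i == k)%:R.
have dL : \det L = 1.
  rewrite det_trig; last first.
    apply/is_trig_mxP => i k ik; rewrite mxE ltnNge ltnW //=.
    by case: eqP ik => // ->; rewrite ltnn.
  by rewrite big1 // => i _; rewrite mxE ltnn eqxx.
rewrite -[RHS]mul1r -dL -det_mulmx; congr (\det _).
apply/matrixP => i j; rewrite !mxE Hl (bigID (fun k : 'I_N => (k < i)%N)) /= [RHS]addrC.
congr (_ + _).
  rewrite (bigD1 i) ?ltnn //= !mxE ltnn eqxx mul1r big1 ?addr0 // => k /andP[ki nk].
  by rewrite !mxE (negbTE ki) eq_sym (negbTE nk) mul0r.
rewrite (big_nth 0%N) size_takel ?zC ?(ltnW (ltn_ord i)) //.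
rewrite big_mkord (big_ord_widen N (fun k => l i (nth 0%N (take i C) k) * gw (nth 0%N (take i C) k) (nth 0%N S j))) ?(ltnW (ltn_ord i)) //.
by apply: eq_bigr => k ki; rewrite !mxE ki !nth_take.
Qed.

End Weights.

(** * The determinant of two sorted columns *)

(* Two sorted columns of equal length with [S] entrywise at most [D]: pairing the new
   entries with the old ones in order gives the intervals [b_j, d_j]. *)
Definition matching (D S : seq nat) : seq (nat * nat) :=
  zip [seq x <- S | x \notin D] [seq x <- D | x \notin S].

Definition meets (p q : nat * nat) : bool := (p.1 <= q.2)%N && (q.1 <= p.2)%N.

Definition disjoint_intervals (P : seq (nat * nat)) : bool :=
  all (fun p => all (fun q => (p != q) ==> ~~ meets p q) P) P.

(** This is [Ncheck + Nhat] without reference to rows. *)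
Definition common_inside (D S : seq nat) (P : seq (nat * nat)) : nat :=
  \sum_(p <- P) count (fun k => (k \in S) && (p.1 < k < p.2))%N D.

Lemma disjoint_intervals_cons p P : all (fun q => (p != q) ==> ~~ meets p q) P ->
  disjoint_intervals (p :: P) = disjoint_intervals P.
Proof.
move=> pP; rewrite /disjoint_intervals /= eqxx /= pP /=.
apply: eq_in_all => q qP; rewrite /= andbC.
have := allP pP q qP; rewrite eq_sym /meets andbC => ->.
by rewrite andbT.
Qed.

Lemma det_row0 (R : comNzRingType) (N : nat) (g : nat -> nat -> R) :
  \det (\matrix_(i < N.+1, j < N.+1) g i j)
  = \sum_(j < N.+1) (-1) ^+ j * g 0%N j * \det (\matrix_(i < N, k < N) g i.+1 (bump j k)).
Proof.
rewrite (expand_det_row _ ord0); apply: eq_bigr => j _.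
rewrite /cofactor mxE /= add0n mulrCA mulrA; congr (_ * \det _).
by apply/matrixP=> i k; rewrite !mxE.
Qed.

Section DetGw.
Variables (R : comNzRingType) (t : R).

Definition pair_factor (D S : seq nat) : R :=
  if disjoint_intervals (matching D S)
  then (- t) ^+ common_inside D S (matching D S) * (1 - t) ^+ size (matching D S)
  else 0.

Lemma matching_sub (D S : seq nat) p : p \in matching D S ->
  [/\ p.1 \in S, p.1 \notin D, p.2 \in D & p.2 \notin S].
Proof.
case: p => b d pP.
have bP : b \in unzip1 (matching D S) by apply: (map_f fst pP).
have dP : d \in unzip2 (matching D S) by apply: (map_f snd pP).
have {bP} : b \in [seq x <- S | x \notin D].
  move: bP; rewrite /matching; elim: [seq x <- S | _] [seq x <- D | _] => [|x s IH] [|y u] //=.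
  by rewrite !inE => /orP[->//|/IH ->]; rewrite orbT.
have {dP} : d \in [seq x <- D | x \notin S].
  move: dP; rewrite /matching; elim: [seq x <- S | _] [seq x <- D | _] => [|x s IH] [|y u] //=.
  by rewrite !inE => /orP[->//|/IH ->]; rewrite orbT.
by rewrite !mem_filter => /andP[-> ->] /andP[-> ->].
Qed.

Lemma filter_notin_cons (x : nat) (A B : seq nat) : x \notin A ->
  [seq y <- A | y \notin x :: B] = [seq y <- A | y \notin B].
Proof.
move=> xA; apply: eq_in_filter => y yA; rewrite inE negb_or.
by case: eqP => // e; rewrite -e yA in xA.
Qed.

(** This lemma and the next three give [pair_factor] the same recursion as the Laplace expansion in
    [det_gw]. Here [x] lies below every left endpoint, hence inside no interval. *)
Lemma pair_factor_common (x : nat) (D S : seq nat) :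
  all (ltn x) D -> all (ltn x) S -> pair_factor (x :: D) (x :: S) = pair_factor D S.
Proof.
move=> xD xS.
have xnD : x \notin D by apply/negP => /(allP xD); rewrite /= ltnn.
have xnS : x \notin S by apply/negP => /(allP xS); rewrite /= ltnn.
have e : matching (x :: D) (x :: S) = matching D S.
  by rewrite /matching /= !inE eqxx /= !filter_notin_cons.
rewrite /pair_factor e; congr (if _ then _ ^+ _ * _ else _).
rewrite /common_inside big_seq [RHS]big_seq; apply: eq_bigr => p /matching_sub[pS _ _ _].
have xp := allP xS _ pS.
rewrite /= [(p.1 < x)%N]ltnNge (ltnW xp) /= andbF add0n.
apply: eq_in_count => k kD; rewrite inE; case: eqP => // e'.
by rewrite e' (negbTE xnD) in kD.
Qed.

Lemma pair_factor_inside (s d : nat) (D S : seq nat) :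
  (s < d)%N -> all (ltn d) D -> all (ltn d) S -> uniq D ->
  size D = size (s :: S) ->
  pair_factor (d :: D) (s :: d :: S) = - t * pair_factor D (s :: S).
Proof.
move=> sd dD dS uD zDS.
have dnD : d \notin D by apply/negP => /(allP dD); rewrite /= ltnn.
have dnS : d \notin S by apply/negP => /(allP dS); rewrite /= ltnn.
have snD : s \notin D by apply/negP => /(allP dD) /= ?; lia.
have snS : s \notin S by apply/negP => /(allP dS) /= ?; lia.
have e : matching (d :: D) (s :: d :: S) = matching D (s :: S).
  rewrite /matching /= !inE eqxx orbT /= negb_or snD (ltn_eqF sd) /=.
  rewrite filter_notin_cons //; congr (zip (_ :: _) _).
  apply: eq_in_filter => y yD; rewrite !inE; congr (~~ (_ || _)).
  by case: eqP => // e; rewrite -e yD in dnD.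
(* Pigeonhole: [D] has one element more than [S] and avoids [s], so some element of [D] is unmatched
   and [s] has a partner [y]. As [d] lies between [s] and [y], while all other intervals start above
   [d], it is counted exactly once. *)
have [y [E1 eE]] : exists y E1, [seq x <- D | x \notin s :: S] = y :: E1.
  case h : [seq x <- D | x \notin s :: S] => [|y E1]; last by exists y, E1.
  have sub : {subset D <= S}.
    move=> x xD; have : x \notin [seq x <- D | x \notin s :: S] by rewrite h.
    rewrite mem_filter xD andbT negbK inE => /orP[/eqP xs|//].
    by rewrite -xs xD in snD.
  by have := uniq_leq_size uD sub; rewrite zDS /= ltnn.
have yd : (d < y)%N.
  have : y \in [seq x <- D | x \notin s :: S] by rewrite eE mem_head.
  by rewrite mem_filter => /andP[_ /(allP dD)].
rewrite /pair_factor e; case: ifP => _; last by rewrite mulr0.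
suff -> : common_inside (d :: D) (s :: d :: S) (matching D (s :: S))
        = (common_inside D (s :: S) (matching D (s :: S))).+1 by rewrite exprS !mulrA.
have cE p : count (fun k => (k \in s :: d :: S) && (p.1 < k < p.2)%N) (d :: D)
   = ((p.1 < d < p.2)%N + count (fun k => (k \in s :: S) && (p.1 < k < p.2)) D)%N.
  rewrite /= !inE eqxx orbT /=; congr (_ + _)%N; apply: eq_in_count => k kD.
  by rewrite !inE; case: (k =P d) => // e'; rewrite -e' kD in dnD.
have eM : matching D (s :: S) = (s, y) :: zip [seq x <- S | x \notin D] E1.
  by rewrite /matching /= snD eE.
rewrite /common_inside; under eq_bigr do rewrite cE.
rewrite big_split -[RHS]add1n; congr addn; rewrite eM big_cons /= sd yd.
rewrite big_seq big1 // => p pP.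
have : p.1 \in [seq x <- S | x \notin D].
  move: pP; elim: [seq x <- S | _] E1 {eE eM} => [|z u IH] [|y' v] //=.
  by rewrite inE => /orP[/eqP -> /=|/IH]; rewrite inE ?eqxx // => ->; rewrite orbT.
rewrite mem_filter => /andP[_ /(allP dS)] /= dp.
by rewrite ltnNge (ltnW dp).
Qed.

Lemma pair_factor_pair (s d : nat) (D S : seq nat) :
  (s < d)%N -> all (ltn d) D -> all (ltn d) S ->
  pair_factor (d :: D) (s :: S) = (1 - t) * pair_factor D S.
Proof.
move=> sd dD dS.
have dnD : d \notin D by apply/negP => /(allP dD); rewrite /= ltnn.
have dnS : d \notin S by apply/negP => /(allP dS); rewrite /= ltnn.
have snD : s \notin D by apply/negP => /(allP dD) /= ?; lia.
have snS : s \notin S by apply/negP => /(allP dS) /= ?; lia.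
have e : matching (d :: D) (s :: S) = (s, d) :: matching D S.
  rewrite /matching /= !inE negb_or snD (ltn_eqF sd) gtn_eqF //= dnS /=.
  by rewrite !filter_notin_cons.
rewrite /pair_factor e disjoint_intervals_cons; last first.
  apply/allP => p /matching_sub[pS _ _ _]; apply/implyP => _.
  have := allP dS _ pS; rewrite /meets /= => h; rewrite [(p.1 <= d)%N]leqNgt h andbF //.
case: ifP => _; last by rewrite mulr0.
suff -> : common_inside (d :: D) (s :: S) ((s, d) :: matching D S)
   = common_inside D S (matching D S) by rewrite /= exprS mulrCA.
have cE p : (p == (s, d)) || (p \in matching D S) ->
   count (fun k => (k \in s :: S) && (p.1 < k < p.2)%N) (d :: D)
   = (count (fun k => (k \in S) && (p.1 < k < p.2)) D)%N.
  move=> pP; rewrite /= !inE (negbTE dnS) gtn_eqF //= add0n.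
  apply: eq_in_count => k kD; rewrite !inE; case: (k =P s) => // e'.
  by rewrite e' (negbTE snD) in kD.
rewrite /common_inside big_seq; under eq_bigr => p pP.
  rewrite cE -?in_cons //; over.
rewrite -big_seq big_cons -[RHS]add0n; congr (_ + _)%N.
apply/eqP; rewrite -leqn0 leqNgt -has_count; apply/hasPn => k /(allP dD) /= dk.
by rewrite [(k < d)%N]ltnNge (ltnW dk) !andbF.
Qed.

Lemma pair_factor_meet (s1 s2 d : nat) (D S : seq nat) :
  (s1 < s2)%N -> (s2 < d)%N -> sorted ltn (d :: D) -> uniq (s1 :: s2 :: S) ->
  size D = size (s2 :: S) -> pair_factor (d :: D) (s1 :: s2 :: S) = 0.
Proof.
move=> s12 s2d sD uS zDS.
have dD : all (ltn d) D by apply: (order_path_min ltn_trans).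
have s1D : s1 \notin d :: D by rewrite inE negb_or; apply/andP; split; [|apply/negP => /(allP dD) /= ?]; lia.
have s2D : s2 \notin d :: D by rewrite inE negb_or; apply/andP; split; [|apply/negP => /(allP dD) /= ?]; lia.
(* Of the [size S + 2] elements of [d :: D], at most [size S] are common, since neither [s1] nor
   [s2] is. So [s1] and [s2] both have partners, which are at least [d], and their intervals
   meet. *)
have : (2 <= size [seq x <- d :: D | x \notin s1 :: s2 :: S])%N.
  have uD : uniq (d :: D) by move: sD; rewrite ltn_sorted_uniq_leq => /andP[].
  have : (size [seq x <- d :: D | x \in s1 :: s2 :: S] <= size S)%N.
    apply: uniq_leq_size; first exact: filter_uniq.
    move=> x; rewrite mem_filter => /andP[xS xD]; move: xS; rewrite !inE.
    by case: eqP => [e|_]; [rewrite -e xD in s1D|case: eqP => [e|_]; [rewrite -e xD in s2D|]].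
  have := count_predC (mem (s1 :: s2 :: S)) (d :: D).
  rewrite -!size_filter; move: (size [seq x <- d :: D | x \in _]) => a.
  by rewrite [size (d :: D)]/= zDS /= /predC /=; set b := size _; set c := size _; lia.
rewrite /pair_factor /matching; set E := filter _ (d :: D) => zE.
have Ed x : x \in E -> (d <= x)%N.
  by rewrite mem_filter inE => /andP[_ /orP[/eqP->|/(allP dD)/ltnW]].
rewrite (_ : filter _ (s1 :: s2 :: S) = s1 :: s2 :: [seq x <- S | x \notin d :: D]); last first.
  by rewrite [LHS]/= s1D s2D.
case: E zE Ed => [|y1 [|y2 E]] //= _ Ed.
rewrite ifF //; apply/negbTE; rewrite /disjoint_intervals /= !xpair_eqE (ltn_eqF s12) /= /meets /=.
have y1d := Ed y1 (mem_head _ _).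
have y2d : (d <= y2)%N by apply: Ed; rewrite !inE eqxx orbT.
by rewrite !(ltnW (leq_trans _ y2d)) ?(ltn_trans s12) // ?(ltnW (leq_trans s2d y1d)) //= andbF.
Qed.

(* Expand along the row of the smallest [d] of [D], comparing it with the two
   smallest elements [s1 < s2] of [S]: the determinant picks up the factor [1] if
   [s1 = d], [0] if [s2 < d] (two equal columns), [- t] if [s2 = d], and [1 - t] if
   [s1 < d < s2]. *)
Lemma det_gw (N : nat) (D S : seq nat) :
  sorted ltn D -> sorted ltn S -> size D = N -> size S = N ->
  (forall i, i < N -> nth 0 S i <= nth 0 D i)%N ->
  \det (\matrix_(i < N, j < N) gw t (nth 0%N D i) (nth 0%N S j)) = pair_factor D S.
Proof.
elim: N D S => [|N IH] D S sD sS zD zS le.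
  by rewrite (size0nil zD) (size0nil zS) det_mx00 /pair_factor /= /common_inside big_nil expr0 mul1r.
case: D sD zD le => // d D sD [zD] le; case: S sS zS le => // s S sS [zS] le.
have dD : all (ltn d) D by apply: (order_path_min ltn_trans).
have sSm : all (ltn s) S by apply: (order_path_min ltn_trans).
have sD' := path_sorted sD; have sS' := path_sorted sS.
have dDn (i : 'I_N) : (d < nth 0%N D i)%N by apply: (allP dD); rewrite mem_nth // zD.
have first_entry : all (ltn d) S ->
   \det (\matrix_(i < N.+1, j < N.+1) gw t (nth 0%N (d :: D) i) (nth 0%N (s :: S) j))
   = gw t d s * pair_factor D S.
  move=> dS; rewrite (det_row0 _ (fun i j => gw t (nth 0%N (d :: D) i) (nth 0%N (s :: S) j))).
  rewrite big_ord_recl big1 ?addr0 /= ?mul1r.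
    by rewrite -IH // => i iN; apply: (le i.+1).
  move=> j _; have : (d < nth 0%N S j)%N by apply: (allP dS); rewrite mem_nth // zS.
  by rewrite /gw => h; rewrite gtn_eqF // ltnNge (ltnW h) mulr0 mul0r.
have := le 0%N isT; rewrite /= leq_eqVlt => /orP[/eqP e|sd].
  by rewrite first_entry -?e // /gw eqxx mul1r pair_factor_common // e.
case: S sS zS le sSm sS' first_entry => [|s2 S] sS zS le sSm sS' first_entry.
  rewrite first_entry // /gw (ltn_eqF sd) sd pair_factor_pair //.
have s2S : all (ltn s2) S by apply: (order_path_min ltn_trans).
have := sSm; rewrite /= => /andP[ss2 sSS].
case: (ltngtP s2 d) => s2d.
- rewrite pair_factor_meet ?zD //; last by move: sS; rewrite ltn_sorted_uniq_leq => /andP[].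
  case: N {IH} zD zS le dDn first_entry => // N zD zS le dDn _.
  rewrite -det_tr (determinant_alternate (i1 := ord0) (i2 := lift ord0 ord0)) // => i.
  rewrite !mxE /= /gw.
  have di : (d <= nth 0%N (d :: D) i)%N.
    by case: i => -[|i] //= iN; apply/ltnW/(dDn (Ordinal (iN : (i < N.+1)%N))).
  by rewrite !ltn_eqF ?(leq_trans _ di) ?(ltn_trans ss2).
- rewrite first_entry; last by rewrite /= s2d; apply: sub_all s2S => x /= ?; lia.
  rewrite /gw (ltn_eqF sd) sd pair_factor_pair //= s2d.
  by apply: sub_all s2S => x /= ?; lia.
subst s2; case: N IH zD zS le dDn first_entry => // N IH zD [zS] le dDn _.
have uD : uniq D by move: sD'; rewrite ltn_sorted_uniq_leq => /andP[].
rewrite pair_factor_inside //; last by rewrite zD /= zS.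
rewrite -(IH D (s :: S)) //=; first last.
- case=> [|i] iN /=; first exact: (ltnW (ltn_trans sd (dDn ord0))).
  exact: (le i.+2).
- by rewrite zS.
- by move: sS' sSS; case: (S) => //= x S1 /andP[_ ->] /andP[->].
rewrite (det_row0 _ (fun i j => gw t (nth 0%N (d :: D) i) (nth 0%N (s :: d :: S) j))).
rewrite !big_ord_recl big1 ?addr0 /=; last first.
  move=> j _; have : (d < nth 0%N S j)%N by apply: (allP s2S); rewrite mem_nth // zS.
  by rewrite /gw => h; rewrite gtn_eqF // ltnNge (ltnW h) mulr0 mul0r.
(* All rows after the first belong to elements above [d], so there the columns of [s] and [d] are
   both constantly [1 - t]. The two minors coincide and combine with coefficient
   [(1 - t) - 1 = - t]. *)
set d0 := \det (\matrix_(i < N.+1, k < N.+1) gw t (nth 0%N D i) (nth 0%N (s :: d :: S) (bump 0 k))).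
set d1 := \det (\matrix_(i < N.+1, k < N.+1) gw t (nth 0%N D i) (nth 0%N (s :: d :: S) (bump (bump 0 0) k))).
have -> : d1 = \det (\matrix_(i < N.+1, j < N.+1) gw t (nth 0%N D i) (nth 0%N (s :: S) j)).
  by congr (\det _); apply/matrixP => i [[|k] kN]; rewrite !mxE.
have -> : d0 = \det (\matrix_(i < N.+1, j < N.+1) gw t (nth 0%N D i) (nth 0%N (s :: S) j)).
  congr (\det _); apply/matrixP => i [[|k] kN]; rewrite !mxE //= /gw.
  by rewrite !ltn_eqF ?dDn ?(ltn_trans sd).
by rewrite /gw eqxx (ltn_eqF sd) sd /bump /=; ring.
Qed.

End DetGw.

(** * Summing over one column *)

(* In the following row statistics the rows are numbered from 0. *)
Definition row_compatible (C C' : seq nat) (j : nat) : bool :=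
  ((j < size C') ==> (nth 0 C j <= nth 0 C' j))%N && (nth 0%N C j \notin take j C').

Definition row_inv (C C' : seq nat) (j : nat) : nat :=
  count (fun y => (nth 0 C j < y) && ((j < size C') ==> (y < nth 0 C' j)))%N (take j C').

Definition row_des (C C' : seq nat) (j : nat) : nat :=
  nat_of_bool ((j < size C') && (nth 0 C j < nth 0 C' j))%N.

(** Local conditions encoded by zero factors become one global condition. This serves for the rows
    of a column, for the columns of a filling, and for the Non-overlapping Condition. *)
Lemma prod_if (R : comNzRingType) (N : nat) (a : nat -> bool) (F : nat -> R) :
  \prod_(j < N) (if a j then F j else 0)
  = if [forall j : 'I_N, a j] then \prod_(j < N) F j else 0.
Proof.
case: forallP => [h|h]; first by apply: eq_bigr => j _; rewrite h.
have /existsP[j nj] : [exists j : 'I_N, ~~ a j].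
  by rewrite -negb_forall; apply/negP => /forallP.
by rewrite (bigD1 j) //= (negbTE nj) mul0r.
Qed.

(** With a boolean [e], the sequence [nseq e B] is either empty or the single virtual entry. Placed
    last and larger than the rest, that entry creates no inversion and stays last under sorting. *)
Lemma ell_cat_max (C : seq nat) (e : bool) (B : nat) : all (gtn B) C -> ell (C ++ nseq e B) = ell C.
Proof.
elim: C => [|x C IH] /=.
  by case: e => //=; rewrite ell_cons /ell /= big_ord0.
case/andP=> xB CB; rewrite !ell_cons IH // count_cat; congr (_ + _)%N.
by case: (e); rewrite /= ?addn0 // ltnNge (ltnW xB) addn0.
Qed.

Lemma sort_cat_max (C : seq nat) (e : bool) (B : nat) : all (gtn B) C ->
  sort leq (C ++ nseq e B) = sort leq C ++ nseq e B.
Proof.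
move=> CB; apply: (sorted_eq leq_trans anti_leq).
- exact: (sort_sorted leq_total).
- case: e; last by rewrite cats0 (sort_sorted leq_total).
  rewrite sorted_pairwise; last exact: leq_trans.
  rewrite pairwise_cat /= andbT -sorted_pairwise; last exact: leq_trans.
  rewrite (sort_sorted leq_total) andbT; apply/allrelP => x y.
  by rewrite mem_sort inE => /(allP CB) xB /eqP ->; apply: ltnW.
- by rewrite perm_sort perm_cat2r perm_sym perm_sort.
Qed.

Lemma ltn_add_bool (i c : nat) (e : bool) : (i < c + e -> c <= i -> e /\ i = c)%N.
Proof. by case: e => /= ? ?; split=> //; lia. Qed.

Lemma uniq_cat_max (C : seq nat) (e : bool) (B : nat) :
  uniq C -> all (gtn B) C -> uniq (C ++ nseq e B).
Proof.
move=> uC CB; rewrite cat_uniq uC /=; case: e => //=; rewrite orbF andbT.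
by apply/negP => /(allP CB); rewrite /= ltnn.
Qed.

Lemma leq_nth_cat_max (S C : seq nat) (e : bool) (B : nat) :
  size S = (size C + e)%N -> all (gtn B) S ->
  (forall i, i < size C -> nth 0 S i <= nth 0 C i)%N ->
  forall i, (i < size S -> nth 0 S i <= nth 0 (C ++ nseq e B) i)%N.
Proof.
move=> zS SB le i iS; rewrite nth_cat; case: ltnP => iC; first exact: le.
move: (iS); rewrite zS => iS'; have [e1 ei] := ltn_add_bool iS' iC.
by rewrite e1 ei subnn /= -ei; apply/ltnW/(allP SB)/mem_nth.
Qed.

Section PairWeight.
Variables (R : idomainType) (t : R).

(** The share of two adjacent columns in the weight of a filling. Distinctness inside a column is
    not tested, as columns will be orderings of a strictly increasing one. *)
Definition pair_weight (C C' : seq nat) : R :=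
  if [forall j : 'I_(size C), row_compatible C C' j]
  then t ^+ (\sum_(j < size C) row_inv C C' j) * (1 - t) ^+ (\sum_(j < size C) row_des C C' j)
  else 0.

(* A virtual maximal entry [B] in the missing row of [C'] turns the row of [C] without
   right neighbour into an ordinary one, at the cost of one factor [1 - t]. *)
Lemma pair_weight_rw (C C' : seq nat) (e : bool) (B : nat) :
  uniq C' -> all (gtn B) C -> all (gtn B) C' -> size C = (size C' + e)%N ->
  (1 - t) ^+ e * pair_weight C C' =
  \prod_(j < size C) rw t (take j (C' ++ nseq e B)) (nth 0%N (C' ++ nseq e B) j) (nth 0%N C j).
Proof.
move=> uC' CB CB' zC; rewrite /pair_weight -!prodrXr -big_split /=.
rewrite -(prod_if _ (row_compatible C C') (fun j => t ^+ row_inv C C' j * (1 - t) ^+ row_des C C' j)).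
have -> : (1 - t) ^+ e = \prod_(j < size C) (if (j < size C')%N then 1 else 1 - t).
  rewrite zC; case: (e) => /=; last by rewrite addn0 big1 // => j _; rewrite ltn_ord.
  rewrite addn1 big_ord_recr /= ltnn big1 ?mul1r ?expr1 // => j _.
  by rewrite ltn_ord.
rewrite -big_split /=; apply: eq_bigr => -[j jC] _ /=.
have jz : (j < size C' + e)%N by rewrite -zC.
rewrite /row_compatible /row_inv /row_des nth_cat.
have -> : take j (C' ++ nseq e B) = take j C'.
  rewrite take_cat; case: ltnP => // h; rewrite [RHS]take_oversize //.
  have -> : (j - size C' = 0)%N by move: jz; case: (e) => /=; lia.
  by rewrite take0 cats0.
case: ltnP => jC' /=.
  rewrite mul1r /rw; have dC' : nth 0%N C' j \notin take j C'.
    have : uniq (take j.+1 C') by rewrite take_uniq.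
    by rewrite (take_nth 0%N) // rcons_uniq => /andP[].
  case: ltngtP => [xd|xd|->] /=.
  - by case: ifP; rewrite ?expr1 // mulrC.
  - by [].
  - rewrite dC' expr0 mulr1 (eq_count (a2 := pred0)) ?count_pred0 // => y /=; lia.
have [e1 je] : e /\ j = size C' by move: jz; case: (e) => /= ?; split=> //; lia.
have xB : (nth 0 C j < B)%N by apply: (allP CB); rewrite mem_nth.
rewrite e1 je subnn /= /rw -je ltn_eqF // xB /= expr0 mulr1.
case: ifP => _; last by rewrite mulr0.
congr (_ * _ ^+ _); apply: eq_in_count => y /mem_take yC'.
by rewrite andbT [(y < B)%N](allP CB' _ yC') andbT.
Qed.

Lemma signed_sum_pair (S C' : seq nat) (e : bool) (B : nat) :
  sorted ltn S -> uniq C' -> size S = (size C' + e)%N ->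
  all (gtn B) S -> all (gtn B) C' ->
  (forall i, i < size C' -> nth 0 S i <= nth 0 (sort leq C') i)%N ->
  (1 - t) ^+ e * \sum_(C <- permutations S) (-1) ^+ ell C * pair_weight C C'
  = (-1) ^+ ell C' * pair_factor t (sort leq C' ++ nseq e B) S.
Proof.
move=> sS uC' zS SB CB le; set D := C' ++ nseq e B.
have zD : size D = size S by rewrite size_cat size_nseq zS.
have uD : uniq D by apply: uniq_cat_max.
rewrite mulr_sumr.
transitivity (\sum_(C <- permutations S) (-1) ^+ ell C *
    \prod_(j < size S) rw t (take j D) (nth 0%N D j) (nth 0%N C j)).
  rewrite big_seq [RHS]big_seq; apply: eq_bigr => C.
  rewrite mem_permutations => pC; rewrite mulrCA -(perm_size pC).
  rewrite (@pair_weight_rw _ _ _ B) //; last by rewrite (perm_size pC).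
  by rewrite (perm_all _ pC).
rewrite (signed_sum_permutations (fun j x => rw t (take j D) (nth 0%N D j) x)) //.
rewrite det_rw // (@det_row_order _ _ (fun d j => gw t d (nth 0%N S j))) //.
rewrite ell_cat_max //; congr (_ * _); rewrite -sort_cat_max // -/D.
apply: det_gw; rewrite ?size_sort ?sort_leq_ltn //.
by rewrite /D sort_cat_max //; apply: leq_nth_cat_max; rewrite ?size_sort.
Qed.

End PairWeight.

(** * Intervals and pivot rows *)

(** Trades entrywise comparison of sorted sequences for comparison of counting functions, from which
    common elements can be subtracted. *)
Lemma nth_leq_count (A : seq nat) (i v : nat) : sorted ltn A -> (i < size A)%N ->
  (nth 0 A i <= v)%N = (i < count (fun y => y <= v) A)%N.
Proof.
elim: A i => // x A IH i sA iA.
have xA : all (ltn x) A by apply: (order_path_min ltn_trans).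
have none : (v < x)%N -> count (fun y => y <= v)%N A = 0%N.
  move=> vx; apply/eqP; rewrite -leqn0 leqNgt -has_count.
  by apply/hasPn => y /(allP xA) /= xy; rewrite -ltnNge (ltn_trans vx).
case: i iA => [|i] iA /=.
  case: (leqP x v) => vx; first by [].
  by rewrite none ?add0n.
rewrite IH ?(path_sorted sA) //; case: (leqP x v) => vx; first by [].
by rewrite none ?add0n.
Qed.

Section Matching.
Variables (D S : seq nat).
Hypotheses (sD : sorted ltn D) (sS : sorted ltn S) (zDS : size D = size S).
Hypothesis le : forall i, (i < size S -> nth 0 S i <= nth 0 D i)%N.

Let uD : uniq D. Proof. by move: sD; rewrite ltn_sorted_uniq_leq => /andP[]. Qed.
Let uS : uniq S. Proof. by move: sS; rewrite ltn_sorted_uniq_leq => /andP[]. Qed.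

Lemma perm_common : perm_eq [seq x <- S | x \in D] [seq x <- D | x \in S].
Proof. by apply: uniq_perm; rewrite ?filter_uniq // => x; rewrite !mem_filter andbC. Qed.

Let count_common (a : pred nat) :
  (count a S + count a [seq x <- D | x \notin S] =
   count a D + count a [seq x <- S | x \notin D])%N.
Proof.
rewrite -(permP (permEl (perm_filterC (mem D) S)) a).
rewrite -(permP (permEl (perm_filterC (mem S) D)) a) !count_cat.
by rewrite (permP perm_common a : count a [seq x <- S | mem D x] = _) addnAC.
Qed.

Lemma size_matching :
  size [seq x <- S | x \notin D] = size [seq x <- D | x \notin S].
Proof. by have := count_common predT; rewrite !count_predT zDS => /addnI. Qed.

Lemma count_leq_pointwise (v : nat) :
  (count (fun y => y <= v) D <= count (fun y => y <= v) S)%N.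
Proof.
case h : (count _ D) => [//|k].
have kD : (k < size D)%N by rewrite -h count_size.
have : (nth 0 D k <= v)%N by rewrite nth_leq_count ?h.
by move=> Dv; rewrite -nth_leq_count -?zDS //; apply: leq_trans (le _) Dv; rewrite -zDS.
Qed.

(** Entrywise [S <= D] says that below any bound [S] has at least as many elements as [D]. Removing
    the common elements lowers both counts equally, so the remainders still compare entrywise; the
    comparison is strict because [p.1] is in [S] and [p.2] is not. *)
Lemma matching_lt p : p \in matching D S -> (p.1 < p.2)%N.
Proof.
move=> pM; have [p1 _ _ p2] := matching_sub pM.
have : (p.1 <= p.2)%N; last by rewrite leq_eqVlt => /orP[/eqP e|//]; rewrite -e p1 in p2.
case/(nthP (0, 0)%N): pM => i; rewrite size_zip size_matching minnn => iM <-.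
rewrite nth_zip ?size_matching //=.
set v := nth 0%N [seq x <- D | _] i.
rewrite nth_leq_count ?size_matching ?sorted_filter //; last exact: ltn_trans.
have : (i < count (fun y => y <= v) [seq x <- D | x \notin S])%N.
  by rewrite -nth_leq_count ?sorted_filter //; exact: ltn_trans.
move/leq_trans; apply.
by rewrite -(leq_add2l (count (fun y => y <= v)%N D)) -count_common leq_add2r count_leq_pointwise.
Qed.

End Matching.

Lemma rev_sort_geq (A : seq nat) : sort geq A = rev (sort leq A).
Proof.
apply: (@sorted_eq _ geq).
- by move=> x y z; rewrite /geq /= => xy zx; apply: leq_trans xy.
- by move=> x y; rewrite /geq /= andbC; apply: anti_leq.
- by apply: sort_sorted => x y; apply: leq_total.
- by rewrite rev_sorted; apply: (sort_sorted leq_total).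
- by rewrite perm_sort perm_sym perm_rev perm_sort.
Qed.

Lemma map_ent (A : seq nat) : [seq ent A r | r <- iota 1 (size A)] = A.
Proof.
by rewrite (iotaDl 1 0) -map_comp -[RHS](mkseq_nth 0%N).
Qed.

Section Hat.
Variables (C' S : seq nat) (e : bool) (B : nat).
Hypotheses (uC' : uniq C') (sS : sorted ltn S) (zS : size S = (size C' + e)%N).
Hypotheses (SB : all (gtn B) S) (CB : all (gtn B) C').
Hypothesis le : forall i, (i < size C' -> nth 0 S i <= nth 0 (sort leq C') i)%N.

Let uS : uniq S. Proof. by move: sS; rewrite ltn_sorted_uniq_leq => /andP[]. Qed.
Let D := sort leq C' ++ nseq e B.
Let BS : B \notin S. Proof. by apply/negP => /(allP SB); rewrite /= ltnn. Qed.

Let sD : sorted ltn D.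
Proof. by rewrite /D -sort_cat_max // sort_leq_ltn // uniq_cat_max. Qed.

Let zD : size D = size S. Proof. by rewrite size_cat size_nseq size_sort zS. Qed.

Let leD i : (i < size S -> nth 0 S i <= nth 0 D i)%N.
Proof. by apply: leq_nth_cat_max; rewrite ?size_sort. Qed.

Let E := sort geq [seq x <- S | x \notin C'].
Let F := sort geq [seq x <- C' | x \notin S].
Let E' := if e then behead E else E.
(** Since the entries of [C'] are distinct, each of them names its row; [fill x] is the entry of the
    hat column in the row of [x]. *)
Let fill (x : nat) : nat := if x \in S then x else nth 0%N E' (index x F).

Let hatE : hat C' S = [seq fill x | x <- C'] ++ (if e then [:: head 0%N E] else [::]).
Proof.
by rewrite /hat zS -addn1 eqn_add2l; rewrite /fill /E' /E /F; case: (e).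
Qed.

Let eqDS : [seq x <- S | x \notin D] = [seq x <- S | x \notin C'].
Proof.
apply: eq_in_filter => x xS; rewrite mem_cat mem_sort mem_nseq.
by case: (x =P B) => [h|_]; [move: BS; rewrite -h xS|rewrite andbF orbF].
Qed.

Let eqDF : [seq x <- D | x \notin S] = [seq x <- sort leq C' | x \notin S] ++ nseq e B.
Proof. by rewrite filter_cat; congr (_ ++ _); case: (e) => //=; rewrite BS. Qed.

(** [hat] works in decreasing order and [matching] in increasing order. After reversal, [B] comes
    first and meets the largest new entry, which is the one that [hat] puts in the extra row. *)
Let matchingE : rev (matching D S) = zip E (nseq e B ++ F).
Proof.
rewrite /matching rev_zip; last exact: size_matching.
rewrite eqDS eqDF rev_cat /E /F !(rev_sort_geq [seq _ <- _ | _]).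
rewrite -!(filter_sort leq_total leq_trans).
rewrite (sorted_sort leq_trans (s := S)); last by move: sS; rewrite ltn_sorted_uniq_leq => /andP[].
by case: (e).
Qed.

Let sizeE : size E = (e + size F)%N.
Proof.
have := size_matching sD sS zD; rewrite eqDS eqDF size_cat size_nseq.
by rewrite /E /F !size_sort => ->; rewrite addnC -(size_sort leq) (filter_sort leq_total leq_trans).
Qed.

Let sizeE' : size E' = size F.
Proof. by move: sizeE; rewrite /E'; case: (e) => //=; rewrite size_behead => ->. Qed.

Let uF : uniq F. Proof. by rewrite sort_uniq filter_uniq. Qed.

Let zip_fill : zip E' F = [seq (fill x, x) | x <- F].
Proof.
apply: (@eq_from_nth _ (0, 0)%N); rewrite size_zip sizeE' minnn ?size_map // => i iF.
rewrite nth_zip // (nth_map 0%N) // /fill index_uniq //.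
have : nth 0%N F i \in F by rewrite mem_nth.
by rewrite mem_sort mem_filter => /andP[/negbTE-> _].
Qed.

Let matching_fill : perm_eq (matching D S)
  ([seq (fill x, x) | x <- C' & x \notin S] ++ nseq e (head 0%N E, B)).
Proof.
rewrite -perm_rev matchingE perm_sym.
have -> : zip E (nseq e B ++ F) = nseq e (head 0%N E, B) ++ zip E' F.
  by move: sizeE; rewrite /E'; case: (e) => //=; case: E.
rewrite perm_catC perm_cat2l zip_fill perm_map // perm_sym perm_sort.
by apply: perm_refl.
Qed.

Lemma perm_hat : perm_eq (hat C' S) S.
Proof.
rewrite hatE.
have pC : perm_eq [seq fill x | x <- C'] ([seq x <- C' | x \in S] ++ E').
  rewrite -(permPl (perm_map fill (permEl (perm_filterC (mem S) C')))) map_cat.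
  have -> : [seq fill i | i <- [seq x <- C' | mem S x]] = [seq x <- C' | x \in S].
    rewrite -[RHS]map_id; apply/eq_in_map => x; rewrite mem_filter /fill => /andP[xS _].
    by rewrite [x \in S]xS.
  rewrite perm_cat2l.
  have -> : E' = [seq fill x | x <- F].
    have := congr1 unzip1 zip_fill; rewrite unzip1_zip ?sizeE' // => ->.
    by rewrite /unzip1 -map_comp.
  by rewrite perm_map // perm_sym perm_sort.
rewrite perm_sym -(perm_filterC (mem C') S) perm_sym.
rewrite (perm_trans (y := ([seq x <- C' | x \in S] ++ E') ++ (if e then [:: head 0%N E] else [::]))) //.
  by rewrite perm_cat2r.
rewrite -catA perm_cat //.
  by apply: uniq_perm; rewrite ?filter_uniq // => x; rewrite !mem_filter andbC.
rewrite (perm_trans (y := E)) //; last by rewrite /E perm_sort.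
move: sizeE; rewrite /E'; case: (e) => //=; first by case: E => //= x E0 _; rewrite perm_catC.
by rewrite cats0.
Qed.

Let Ch := hat C' S.
(** The value [d_j] of a pivot row, with [B] in place of infinity. *)
Let entD (r : nat) : nat := ent (C' ++ nseq e B) r.

Let ent_fill r : (0 < r <= size C')%N -> ent Ch r = fill (ent C' r).
Proof.
case: r => // r /= rC; rewrite /ent /Ch hatE nth_cat size_map rC (nth_map 0%N) //.
Qed.

Let entD_lt r : (0 < r <= size C')%N -> entD r = ent C' r.
Proof. by case: r => // r /= rC; rewrite /entD /ent nth_cat rC. Qed.

(** Consequently a row of [C'] is a pivot row exactly when its entry does not occur in [S]. *)
Let fill_lt x : x \in C' -> (fill x < x)%N = (x \notin S).
Proof.
move=> xC; case: (boolP (x \in S)) => xS; first by rewrite /fill xS ltnn.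
apply: (@matching_lt D S sD sS zD leD (fill x, x)).
rewrite (perm_mem matching_fill) mem_cat map_f //.
by rewrite mem_filter xS.
Qed.

Lemma perm_pivots : perm_eq [seq (ent Ch q, entD q) | q <- pivots Ch C'] (matching D S).
Proof.
rewrite perm_sym (perm_trans matching_fill) //.
have zCh : size Ch = (size C' + e)%N by rewrite (perm_size perm_hat).
rewrite /pivots zCh iotaD filter_cat map_cat.
have eq1 : [seq (ent Ch q, entD q) | q <- [seq r <- iota 1 (size C') | is_pivot Ch C' r]]
   = [seq (fill x, x) | x <- C' & x \notin S].
  rewrite -[in RHS](map_ent C') filter_map -map_comp.
  have -> : [seq r <- iota 1 (size C') | is_pivot Ch C' r]
          = [seq r <- iota 1 (size C') | preim (ent C') (fun x => x \notin S) r].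
    apply: eq_in_filter => r; rewrite mem_iota add1n ltnS => rC.
    have [r0 rC'] := andP rC.
    rewrite /is_pivot rC' /= ent_fill // fill_lt; last first.
      by rewrite /ent mem_nth //; case: r r0 rC' {rC}.
    by rewrite ltn_eqF // orbF.
  apply/eq_in_map => r; rewrite mem_filter mem_iota add1n ltnS => /andP[_ rC] /=.
  by rewrite ent_fill // entD_lt.
rewrite eq1 perm_cat2l add1n.
have : e -> is_pivot Ch C' (size C').+1 /\
    (ent Ch (size C').+1, entD (size C').+1) = (head 0%N E, B).
  move=> e1; rewrite /is_pivot eqxx zCh e1 addn1 leqnn orbT; split=> //.
  by rewrite /ent /entD /ent /Ch hatE !nth_cat size_map ltnn subnn e1.
case: (e) => // /(_ isT)[hp he]; rewrite [nseq _ _]/=.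
by rewrite /= hp map_cons he.
Qed.

Let pivot_row q : q \in pivots Ch C' -> (0 < q <= size C' + e)%N.
Proof.
rewrite mem_filter mem_iota => /andP[_]; rewrite (perm_size perm_hat) zS add1n ltnS //.
Qed.

Let entD_dval q x : q \in pivots Ch C' -> (x < B)%N ->
  le_inf x (dval C' q) = (x <= entD q)%N /\ lt_inf x (dval C' q) = (x < entD q)%N.
Proof.
move=> /pivot_row /andP[q0 qe] xB; rewrite /dval; case: (leqP q (size C')) => qC /=.
  by rewrite entD_lt ?q0 ?qC.
have [e1 qE] : e /\ q.-1 = size C' by apply: ltn_add_bool; rewrite ?prednK // -ltnS prednK.
by rewrite /entD /ent qE nth_cat ltnn subnn e1 /= xB ltnW.
Qed.

Let ent_B q : q \in pivots Ch C' -> (ent Ch q < B)%N.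
Proof.
move=> /pivot_row /andP[q0 qe]; apply: (allP SB); rewrite -(perm_mem perm_hat).
by rewrite mem_nth // (perm_size perm_hat) zS; case: q q0 qe.
Qed.

Let uD : uniq (C' ++ nseq e B). Proof. exact: uniq_cat_max. Qed.

Lemma nonoverlap_matching : nonoverlap Ch C' = disjoint_intervals (matching D S).
Proof.
set f := fun q => (ent Ch q, entD q).
have -> : disjoint_intervals (matching D S) = disjoint_intervals [seq f q | q <- pivots Ch C'].
  rewrite /disjoint_intervals -(perm_all _ perm_pivots).
  by apply: eq_all => p; rewrite -(perm_all _ perm_pivots).
have -> : disjoint_intervals [seq f q | q <- pivots Ch C'] =
   all (fun a => all (fun b => (a != b) ==>
       ~~ overlap (ent Ch a) (dval C' a) (ent Ch b) (dval C' b)) (pivots Ch C')) (pivots Ch C').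
  rewrite /disjoint_intervals all_map; apply: eq_in_all => a aP /=.
  rewrite all_map; apply: eq_in_all => b bP /=.
  (* [disjoint_intervals] compares pairs and [nonoverlap] compares rows. They agree because distinct
     rows have distinct right endpoints. *)
  have -> : (f a != f b) = (a != b).
    congr (~~ _); apply/eqP/eqP => [[_]|->//]; rewrite /entD /ent => /eqP.
    have /andP[a0 aC] := pivot_row aP; have /andP[b0 bC] := pivot_row bP.
    rewrite nth_uniq ?size_cat ?size_nseq ?prednK //.
    by move/eqP => h; rewrite -(prednK a0) -(prednK b0) h.
  rewrite /overlap /meets /=.
  by rewrite (entD_dval bP (ent_B aP)).1 (entD_dval aP (ent_B bP)).1.
rewrite /nonoverlap; case: (ltnP 1 (size _)) => //=.
case: (pivots Ch C') => [|a [|b P]] //= _.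
by rewrite eqxx.
Qed.

Lemma Ncheck_Nhat_matching :
  (Ncheck Ch C' + Nhat Ch C')%N = common_inside D S (matching D S).
Proof.
rewrite /common_inside -(perm_big _ perm_pivots) big_map -big_split /=.
rewrite big_seq [RHS]big_seq; apply: eq_bigr => q qP; rewrite -big_split /=.
have pC : perm_eq (sort leq C') [seq ent C' r | r <- iota 1 (size C')].
  by rewrite map_ent perm_sort.
rewrite /D count_cat (permP pC) count_map -sum1_count [in RHS]big_mkcond /=.
have -> : count (fun k => (k \in S) && (ent Ch q < k < entD q)%N) (nseq e B) = 0%N.
  by case: (e) => //=; rewrite (negbTE BS).
rewrite addn0 big_seq [RHS]big_seq; apply: eq_bigr => r.
rewrite mem_iota add1n ltnS => /andP[r0 rC].
have rB : (ent C' r < B)%N by apply: (allP CB); rewrite /ent mem_nth //; case: r r0 rC.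
rewrite (entD_dval qP rB).2 (perm_mem perm_hat).
(* A row other than [q] is eligible for exactly one of the two counts; row [q] itself holds the
   right endpoint, which the strict inequality excludes. *)
case: (ltngtP q r) => qr; rewrite ?andTb ?andFb ?addn0 ?add0n.
- by case: (X in nat_of_bool X).
- by case: (X in nat_of_bool X).
- have -> : entD q = ent C' r by rewrite qr entD_lt // r0.
  by rewrite ltnn !andbF.
Qed.

(** The extra row is a pivot row that [pstat] leaves out. Its factor [1 - t] is the one introduced
    with the virtual entry. *)
Lemma pstat_matching : (pstat Ch C' + e)%N = size (matching D S).
Proof.
rewrite (perm_size matching_fill) size_cat size_nseq size_map; congr (_ + _)%N.
rewrite size_filter -[in RHS](map_ent C') count_map -sum1_count [RHS]big_mkcond /pstat.
rewrite big_seq [RHS]big_seq; apply: eq_bigr => r; rewrite mem_iota add1n ltnS => rC.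
have [r0 rC'] := andP rC; rewrite ent_fill // fill_lt /=; first by case: ifP.
by rewrite /ent mem_nth //; case: r r0 rC' {rC}.
Qed.

Lemma pair_factor_hat (R : comNzRingType) (t : R) :
  pair_factor t D S = (1 - t) ^+ e *
    (if nonoverlap Ch C' then (- t) ^+ (Ncheck Ch C' + Nhat Ch C') * (1 - t) ^+ pstat Ch C'
     else 0).
Proof.
rewrite /pair_factor nonoverlap_matching Ncheck_Nhat_matching -pstat_matching.
by case: ifP => _; rewrite ?mulr0 // exprD; ring.
Qed.

End Hat.

(** * Summing over all columns *)

Section Chain.
Variables (R : idomainType) (t : R).
Hypothesis t1 : 1 - t != 0.

Definition hat_factor (Ch C' : seq nat) : R :=
  if nonoverlap Ch C' then (- t) ^+ (Ncheck Ch C' + Nhat Ch C') * (1 - t) ^+ pstat Ch C'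
  else 0.

(* Columns are indexed from the right: [Q 0] is the last one. *)
Fixpoint column_choices (Q : nat -> seq nat) (k : nat) : seq (seq (seq nat)) :=
  if k is k'.+1 then [seq C :: X | C <- permutations (Q k), X <- column_choices Q k']
  else [seq [:: C] | C <- permutations (Q 0%N)].

Fixpoint chain_weight (X : seq (seq nat)) : R :=
  if X is C :: X' then
    if X' is C' :: _ then pair_weight t C C' * chain_weight X' else 1
  else 1.

Lemma mem_column_choices (Q : nat -> seq nat) (k : nat) (X : seq (seq nat)) :
  (X \in column_choices Q k) =
  (size X == k.+1) && all (fun i => perm_eq (nth [::] X i) (Q (k - i)%N)) (iota 0 k.+1).
Proof.
elim: k X => [|k IH] X.
  apply/mapP/idP => [[C]|]; first by rewrite mem_permutations => h -> /=; rewrite h.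
  case: X => [|C [|C1 X]] //= /andP[h _]; exists C => //.
  by rewrite mem_permutations.
have -> : iota 0 k.+2 = 0%N :: [seq i.+1 | i <- iota 0 k.+1].
  by rewrite -[RHS]/(0%N :: map (addn 1) (iota 0 k.+1)) -iotaDl.
rewrite [column_choices _ _]/= [all _ _]/= all_map; apply/allpairsP/idP => [[[C Y]]|].
  rewrite /= mem_permutations IH => -[CQ /andP[zY aY] ->].
  by rewrite eqSS zY subn0 CQ.
case: X => [|C Y] /and3P[zY CQ aY] //; exists (C, Y).
by rewrite mem_permutations IH -eqSS; split=> //; apply/andP.
Qed.

Lemma column_choices_uniq (Q : nat -> seq nat) (k : nat) : uniq (column_choices Q k).
Proof.
elim: k => [|k IH] /=; first by rewrite map_inj_uniq ?permutations_uniq // => x y [].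
by rewrite allpairs_uniq ?permutations_uniq // => -[x X] [y Y] _ _ [-> ->].
Qed.

(** Summing over the leftmost column replaces its sign by the sign of the next column [C'], which is
    just what the next summation requires. The remaining factor depends only on the set of entries
    of [C'], so it may be evaluated at the ordering [root k]. The last column has a single cell and
    leaves the sign 1. *)
Lemma chain_sum (Q root : nat -> seq nat) (K B : nat) :
  (forall k, k <= K -> sorted ltn (Q k))%N ->
  (forall k, k <= K -> all (gtn B) (Q k))%N ->
  (forall k, k < K -> size (Q k) <= size (Q k.+1) <= (size (Q k)).+1)%N ->
  (forall k i, k < K -> i < size (Q k) -> nth 0 (Q k.+1) i <= nth 0 (Q k) i)%N ->
  size (Q 0%N) = 1%N -> root 0%N = Q 0%N ->
  (forall k, k < K -> root k.+1 = hat (root k) (Q k.+1))%N ->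
  forall k, (k <= K)%N -> perm_eq (root k) (Q k) /\
  \sum_(X <- column_choices Q k) (-1) ^+ ell (head [::] X) * chain_weight X
  = \prod_(i < k) hat_factor (root i.+1) (root i).
Proof.
move=> sQ QB zQ leQ zQ0 r0 rS.
have uQ k : (k <= K)%N -> uniq (Q k).
  by move/sQ; rewrite ltn_sorted_uniq_leq => /andP[].
elim=> [|k IH] kK.
  rewrite r0 big_ord0; split=> //; rewrite /= big_map.
  case: (Q 0%N) zQ0 => // x [|//] _.
  by rewrite big_seq1 /= mulr1 ell_cons /ell /= big_ord0.
have [rQ {}IH] := IH (ltnW kK).
have [e ze] : exists e : bool, size (Q k.+1) = (size (Q k) + e)%N.
  have := zQ k kK; case: (ltngtP (size (Q k)) (size (Q k.+1))) => // h h'.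
    by exists true; move: h'; lia.
  by exists false; rewrite addn0.
(* Used twice: for the column [C'] of the sum and for [root k]. *)
have key C' : perm_eq C' (Q k) ->
   [/\ uniq C', all (gtn B) C', size (Q k.+1) = (size C' + e)%N &
    sort leq C' = Q k].
  move=> pC; split; rewrite ?(perm_uniq pC) ?(perm_all _ pC) ?(perm_size pC) //.
  - by apply: uQ; apply: ltnW.
  - by apply: QB; apply: ltnW.
  - have /(perm_sortP leq_total leq_trans anti_leq) -> := pC.
    apply: (sorted_sort leq_trans).
    by have := sQ k (ltnW kK); rewrite ltn_sorted_uniq_leq => /andP[].
have [ur rB zr sr] := key _ rQ.
have ler i : (i < size (root k) -> nth 0 (Q k.+1) i <= nth 0 (sort leq (root k)) i)%N.
  by rewrite sr (perm_size rQ); apply: leQ.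
split; first by rewrite rS //; apply: (perm_hat ur (sQ _ kK) zr (QB _ kK) rB).
rewrite /= big_allpairs_dep exchange_big big_ord_recr /= -IH mulr_suml.
rewrite big_seq [RHS]big_seq; apply: eq_bigr => X.
rewrite mem_column_choices => /andP[]; case: X => [|C' X] // _ /= /andP[C'Q _].
rewrite subn0 in C'Q; have [uC CB zC sC] := key _ C'Q.
set w := (X in _ = _ * X * _).
transitivity ((\sum_(C <- permutations (Q k.+1)) (-1) ^+ ell C * pair_weight t C C') * w).
  by rewrite mulr_suml; apply: eq_bigr => C _; rewrite mulrA.
rewrite mulrAC; congr (_ * w).
(* Both evaluations carry the factor [(1 - t) ^+ e] of the virtual entry, and it is removed here. *)
apply: (mulfI (expf_neq0 e t1)).
rewrite (signed_sum_pair t (sQ _ kK) uC zC (QB _ kK) CB); last first.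
  by move=> i; rewrite sC (perm_size C'Q); apply: leQ.
rewrite sC -sr (pair_factor_hat ur (sQ _ kK) zr (QB _ kK) rB ler t) -rS //.
by rewrite mulrCA.
Qed.

End Chain.

Lemma sum_iota_trunc (N M : nat) (F : nat -> nat) : (M <= N)%N ->
  (forall i, M < i -> i <= N -> F i = 0)%N ->
  (\sum_(i <- iota 1 N) F i = \sum_(i < M) F i.+1)%N.
Proof.
move=> MN F0; rewrite -(subnKC MN) iotaD big_cat /= [X in (_ + X)%N]big1_seq ?addn0.
  rewrite (iotaDl 1 0) big_map -[RHS](big_mkord xpredT (fun i => F i.+1)) /index_iota subn0.
  by apply: eq_bigr => i _; rewrite add1n.
move=> i /andP[_]; rewrite mem_iota => /andP[i1 i2]; apply: F0 => //.
by move: i2; rewrite -addnA subnKC // add1n ltnS.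
Qed.

Lemma count_take (A : seq nat) (j : nat) (a : pred nat) :
  count a (take j A) = (\sum_(i < minn j (size A)) a (nth 0 A i))%N.
Proof.
rewrite -sum1_count (big_nth 0%N) size_take_min big_mkord big_mkcond /=.
apply: eq_bigr => i _; rewrite nth_take; first by case: (a _).
by apply: (leq_trans (ltn_ord i)); apply: geq_minl.
Qed.

(** * Columns of a shape with distinct parts *)

Section Shape.
Variable mu : seq nat.
Hypotheses (smu : sorted gtn mu) (pmu : all (ltn 0) mu) (nmu : (0 < size mu)%N).

Let gtn_trans : transitive gtn. Proof. by move=> x y z; rewrite /= => xy zx; apply: ltn_trans xy. Qed.

Lemma leq_nth_colLen (k j : nat) : (k < size mu)%N ->
  (j <= nth 0 mu k)%N = (k < colLen mu j)%N.
Proof.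
clear pmu nmu; rewrite /colLen; elim: mu smu k => // x A IH sA k kA.
have xA : all (gtn x) A by apply: (order_path_min gtn_trans).
have none : (x < j)%N -> count (fun y => j <= y)%N A = 0%N.
  move=> vx; apply/eqP; rewrite -leqn0 leqNgt -has_count.
  by apply/hasPn => y /(allP xA) /= yx; rewrite -ltnNge (ltn_trans yx).
case: k kA => [|k] kA /=.
  case: (leqP j x) => vx; first by [].
  by rewrite none ?add0n.
rewrite IH ?(path_sorted sA) //; case: (leqP j x) => vx; first by [].
by rewrite none ?add0n.
Qed.

Lemma colLen_size j : (colLen mu j <= size mu)%N. Proof. exact: count_size. Qed.

Lemma cellE i j : cell mu i j = [&& 0 < i, 0 < j & i <= colLen mu j]%N.
Proof.
rewrite /cell; case: i => //= i; case: ltnP => iN /=.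
  by rewrite leq_nth_colLen.
by rewrite (leqNgt i.+1) (leq_ltn_trans (colLen_size j)) ?ltnS //= andbF.
Qed.

(** The difference of the two lengths is the multiplicity of [j] as a part of [mu], which is at most
    one. *)
Lemma colLenS j : (colLen mu j.+1 <= colLen mu j <= (colLen mu j.+1).+1)%N.
Proof.
have um : uniq mu by apply: (sorted_uniq gtn_trans _ smu) => x; rewrite /= ltnn.
have -> : colLen mu j = (colLen mu j.+1 + count_mem j mu)%N.
  rewrite /colLen; elim: (mu) => //= x A ->; rewrite addnACA; congr addn.
  by rewrite leq_eqVlt eq_sym; case: (ltngtP j x).
by rewrite leq_addr -[X in (_ <= X)%N]addn1 leq_add2l count_uniq_mem //; case: (_ \in _).
Qed.

Lemma ncols_gt0 : (0 < ncols mu)%N.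
Proof. by rewrite /ncols; case: (mu) nmu pmu => //= x A _ /andP[]. Qed.

Lemma colLen_ncols : colLen mu (ncols mu) = 1%N.
Proof.
rewrite /colLen /ncols; case: (mu) nmu smu => // x A _ sA /=.
have xA : all (gtn x) A by apply: (order_path_min gtn_trans).
rewrite leqnn -[RHS]addn0; congr addn; apply/eqP; rewrite -leqn0 leqNgt -has_count.
by apply/hasPn => y /(allP xA) /= yx; rewrite -ltnNge.
Qed.

Lemma colLen_gt0 j : (0 < colLen mu j)%N = (j <= ncols mu)%N.
Proof. by rewrite -leq_nth_colLen // /ncols nth0. Qed.

Lemma cell_ncols i j : cell mu i j -> (0 < j <= ncols mu)%N.
Proof.
by rewrite cellE => /and3P[i0 -> ij]; rewrite -colLen_gt0 (leq_trans i0 ij).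
Qed.

Lemma cell_rows i j : cell mu i j -> (0 < i <= size mu)%N.
Proof.
by rewrite cellE => /and3P[-> _ ij]; rewrite (leq_trans ij (colLen_size j)).
Qed.

Lemma mem_rows i : (i \in rows mu) = (0 < i <= size mu)%N.
Proof. by rewrite mem_iota add1n ltnS. Qed.

Lemma mem_cols j : (j \in cols mu) = (0 < j <= ncols mu)%N.
Proof. by rewrite mem_iota add1n ltnS. Qed.

Lemma size_column F j : size (column mu F j) = colLen mu j.
Proof. by rewrite size_map size_iota. Qed.

Lemma nth_column F j i : (i < colLen mu j)%N -> nth 0%N (column mu F j) i = F i.+1 j.
Proof. by move=> ij; rewrite (nth_map 0%N) ?size_iota // nth_iota // add1n. Qed.

Section Ssyt.
Variables (n : nat) (s : nat -> nat -> nat).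
Hypothesis ssyt : is_ssyt n mu s.

Lemma ssyt_cell i j : cell mu i j ->
  [/\ (1 <= s i j <= n)%N, cell mu i j.+1 -> (s i j <= s i j.+1)%N &
      cell mu i.+1 j -> (s i j < s i.+1 j)%N].
Proof.
move=> cij; have iR : i \in rows mu by rewrite mem_rows (cell_rows cij).
have jC : j \in cols mu by rewrite mem_cols (cell_ncols cij).
have /allP/(_ j jC)/implyP/(_ cij)/and3P[h1 /implyP h2 /implyP h3] := allP ssyt i iR.
by split.
Qed.

Lemma ssyt_column_bound j : (0 < j)%N -> all (fun x => 1 <= x <= n)%N (column mu s j).
Proof.
move=> j0; apply/(all_nthP 0%N) => i; rewrite size_column => ij; rewrite nth_column //.
by have [|] := @ssyt_cell i.+1 j; first by rewrite cellE j0.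
Qed.

Lemma ssyt_column_sorted j : (0 < j)%N -> sorted ltn (column mu s j).
Proof.
move=> j0; apply/(sortedP 0%N) => i; rewrite size_column => ij.
rewrite !nth_column ?(ltnW ij) //.
have [|_ _ h] := @ssyt_cell i.+1 j; first by rewrite cellE j0 (ltnW ij).
by apply: h; rewrite cellE j0.
Qed.

Lemma ssyt_column_leq j i : (0 < j)%N -> (i < colLen mu j.+1)%N ->
  (nth 0 (column mu s j) i <= nth 0 (column mu s j.+1) i)%N.
Proof.
move=> j0 ij; have ij' : (i < colLen mu j)%N by case/andP: (colLenS j) => h _; apply: leq_trans h.
rewrite !nth_column //.
have [|_ h _] := @ssyt_cell i.+1 j; first by rewrite cellE j0.
by apply: h; rewrite cellE.
Qed.

End Ssyt.

End Shape.

Lemma addrho_shape (n : nat) (lam : seq nat) : size lam = n.-1 -> sorted geq lam ->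
  sorted gtn (addrho n lam) /\ all (ltn 0) (addrho n lam).
Proof.
move=> zl sl; split.
  apply/(sortedP 0%N) => i; rewrite /addrho size_map size_iota => iN.
  rewrite !(nth_map 0%N) ?size_iota ?(ltnW iN) // !nth_iota ?(ltnW iN) // !add0n.
  have := sortedP 0%N sl i; rewrite zl => /(_ iN) /=; lia.
by rewrite all_map; apply/allP => i; rewrite mem_iota /= => iN; lia.
Qed.

Lemma chain_weight_map (R : idomainType) (t : R) (f : nat -> seq nat) (a k : nat) :
  chain_weight t [seq f j | j <- iota a k.+1]
  = \prod_(j < k) pair_weight t (f (a + j)%N) (f (a + j).+1%N).
Proof.
elim: k a => [|k IH] a; first by rewrite big_ord0.
rewrite -[LHS]/(pair_weight t (f a) (f a.+1) * chain_weight t [seq f j | j <- iota a.+1 k.+1]).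
rewrite IH big_ord_recl addn0.
by congr (_ * _); apply: eq_bigr => j _; rewrite lift0 addSnnS.
Qed.

(** * Statistics and filling conditions, one pair of columns at a time *)

Section Columns.
Variable mu : seq nat.
Hypotheses (smu : sorted gtn mu) (pmu : all (ltn 0) mu) (nmu : (0 < size mu)%N).
Variable F : nat -> nat -> nat.
Let col := column mu F.
Let K := (ncols mu).-1.

Let colsK : ncols mu = K.+1. Proof. by rewrite prednK // ncols_gt0. Qed.

Let not_last i k : cell mu i k.+1 -> (k <= K)%N.
Proof. by move=> /(cell_ncols smu nmu) /andP[_]; rewrite colsK ltnS. Qed.

Let cellSS i k : cell mu i.+1 k.+1 = (i < size (col k.+1))%N.
Proof. by rewrite cellE // size_column. Qed.

Lemma inv_stat_columns : inv_stat mu F =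
  (\sum_(k < K) \sum_(j < size (col k.+1)) row_inv (col k.+1) (col k.+2) j)%N.
Proof.
rewrite /inv_stat /cols (sum_iota_trunc (leq_pred _)) -/K; last first.
  move=> k Kk kK; rewrite big1 // => j _; rewrite big1 // => i _.
  by case: (boolP (cell mu i k.+1)) => [/not_last|_]; [rewrite leqNgt Kk|rewrite !andbF].
apply: eq_bigr => k _; rewrite (sum_iota_trunc (M := size (col k.+1))); last first.
- move=> [|j] // jC _; rewrite big1 // => i _; rewrite cellSS (leq_gtF (jC : (size _ <= j)%N)).
  by rewrite andbF.
- by rewrite size_column colLen_size.
(* The rows above the current one that have a cell in the next column are exactly the entries of
   [take j] in [row_inv], where [j] counts from 0. *)
apply: eq_bigr => -[j jC] _ /=; rewrite (sum_iota_trunc (M := minn j (size (col k.+2)))); last first.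
- move=> [|i] // iC _; rewrite !cellSS ltnS.
  by move: iC; rewrite ltnS geq_min => /orP[] /leq_gtF ->; rewrite ?andbF.
- by rewrite size_column geq_min colLen_size orbT.
rewrite /row_inv count_take; apply: eq_bigr => -[i /= iC] _.
move: (iC); rewrite leq_min => /andP[ij iC']; rewrite ltnS ij !cellSS jC iC' /=.
rewrite (@nth_column mu F k.+1 j) ?(@nth_column mu F k.+2 i) -?(size_column _ F) //.
by case: (ltnP j (size (col k.+2))) => jC' /=; rewrite ?andbT // nth_column -?(size_column _ F).
Qed.

Lemma des_stat_columns : des_stat mu F =
  (\sum_(k < K) \sum_(j < size (col k.+1)) row_des (col k.+1) (col k.+2) j)%N.
Proof.
rewrite /des_stat exchange_big /= /cols (sum_iota_trunc (leq_pred _)) -/K; last first.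
  move=> k Kk kK; rewrite big1 // => i _.
  by case: (boolP (cell mu i k.+1)) => [/not_last|_]; [rewrite leqNgt Kk|rewrite !andbF].
apply: eq_bigr => k _; rewrite (sum_iota_trunc (M := size (col k.+1))); last first.
- by move=> [|j] // jC _; rewrite cellSS (leq_gtF (jC : (size _ <= j)%N)).
- by rewrite size_column colLen_size.
apply: eq_bigr => -[j jC] _ /=; rewrite /row_des !cellSS jC /=.
by case: (ltnP j (size (col k.+2))) => //= jC'; rewrite !nth_column -?(size_column _ F).
Qed.

(** The hypothesis settles the bounds and the attacks within a column; what remains of [inF] relates
    adjacent columns only. *)
Lemma inF_columns (n : nat) :
  (forall j, 0 < j <= ncols mu -> uniq (col j) /\ all (fun x => 1 <= x <= n) (col j))%N ->
  inF n mu F = [forall k : 'I_K, [forall j : 'I_(size (col k.+1)),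
                                    row_compatible (col k.+1) (col k.+2) j]].
Proof.
move=> colP; apply/idP/forallP => [/allP inFn k|ok].
  apply/forallP => -[i /= iC].
  have use i' j' k' l' : cell mu i' j' -> cell mu k' l' ->
     [&& cell mu i' j' ==> (1 <= F i' j' <= n),
         [&& cell mu i' j', cell mu k' l', l' == j' & i' != k'] ==> (F i' j' != F k' l'),
         [&& cell mu i' j', cell mu k' l', l' == j'.+1 & k' < i'] ==> (F i' j' != F k' l') &
         [&& cell mu i' j', cell mu i' j'.+1, k' == i' & l' == j'.+1] ==> (F i' j' <= F k' l')]%N.
    move=> c1 c2.
    have/allP := inFn i' ltac:(by rewrite mem_rows (cell_rows smu c1)).
    move/(_ j' ltac:(by rewrite mem_cols (cell_ncols smu nmu c1)))/allP.
    move/(_ k' ltac:(by rewrite mem_rows (cell_rows smu c2)))/allP.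
    by move/(_ l' ltac:(by rewrite mem_cols (cell_ncols smu nmu c2))).
  have c1 : cell mu i.+1 k.+1 by rewrite cellSS.
  rewrite /row_compatible nth_column -?(size_column _ F) //; apply/andP; split.
    apply/implyP => iC'; have c2 : cell mu i.+1 k.+2 by rewrite cellSS.
    rewrite nth_column -?(size_column _ F) //.
    by have /and4P[_ _ _] := use _ _ _ _ c1 c2; rewrite c1 c2 !eqxx.
  apply/negP => /(nthP 0%N)[r]; rewrite size_take_min leq_min => /andP[ri rC].
  rewrite nth_take // nth_column -?(size_column _ F) // => eqF.
  have c2 : cell mu r.+1 k.+2 by rewrite cellSS.
  have /and4P[_ _ + _] := use _ _ _ _ c1 c2.
  by rewrite c1 c2 eqxx ltnS ri eqF eqxx.
have compat i k : cell mu i.+1 k.+1 -> (k < K)%N -> row_compatible (col k.+1) (col k.+2) i.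
  rewrite cellSS => iC kK.
  by have /forallP/(_ (Ordinal iC)) := ok (Ordinal kK).
apply/allP => -[|i] iR; first by rewrite mem_rows in iR.
apply/allP => -[|j] jC; first by rewrite mem_cols in jC.
apply/allP => -[|k] kR; first by rewrite mem_rows in kR.
apply/allP => -[|l] lC; first by rewrite mem_cols in lC.
rewrite mem_cols in jC; have [uC bC] := colP _ jC.
apply/and4P; split; apply/implyP.
- rewrite cellSS => iC; apply: (allP bC); rewrite -(@nth_column mu F) -?(size_column _ F) //.
  exact: mem_nth.
- case/and4P; rewrite !cellSS => iC kC /eqP[lj] ik; rewrite lj in kC *.
  rewrite -(@nth_column mu F) -?(size_column _ F) // -(@nth_column mu F j.+1 k) -?(size_column _ F) //.
  by rewrite nth_uniq.
- case/and4P => ic kc /eqP[lj] ki; rewrite lj in kc *.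
  have /andP[_] := compat _ _ ic (not_last kc).
  apply: contraNN => /eqP eqF; rewrite cellSS in ic; rewrite cellSS in kc.
  rewrite nth_column -?(size_column _ F) // eqF -(@nth_column mu F) -?(size_column _ F) //.
  rewrite -(@nth_take i) //; apply: mem_nth.
  by rewrite size_take_min leq_min (ki : (k < i)%N) kc.
- case/and4P => ic ic' /eqP[ki] /eqP[lj]; rewrite ki lj.
  have /andP[+ _] := compat _ _ ic (not_last ic').
  rewrite cellSS in ic; rewrite cellSS in ic'.
  by rewrite ic' /= !nth_column -?(size_column _ F).
Qed.

Lemma chain_weight_columns (R : idomainType) (t : R) (n : nat) :
  (forall j, 0 < j <= ncols mu -> uniq (col j) /\ all (fun x => 1 <= x <= n) (col j))%N ->
  chain_weight t [seq col j | j <- cols mu]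
  = if inF n mu F then t ^+ inv_stat mu F * (1 - t) ^+ des_stat mu F else 0.
Proof.
move=> colP; rewrite inF_columns // inv_stat_columns des_stat_columns /cols colsK.
rewrite chain_weight_map -!prodrXr -big_split /=.
by rewrite -(@prod_if R K (fun k => [forall j : 'I_(size (col k.+1)), row_compatible (col k.+1) (col k.+2) j])
  (fun k => t ^+ (\sum_(j < size (col k.+1)) row_inv (col k.+1) (col k.+2) j)
     * (1 - t) ^+ (\sum_(j < size (col k.+1)) row_des (col k.+1) (col k.+2) j))).
Qed.

End Columns.

(** * Fillings as sequences of columns *)

Section Fillings.
Variables (mu : seq nat) (n : nat) (s : nat -> nat -> nat).
Hypotheses (smu : sorted gtn mu) (pmu : all (ltn 0) mu) (nmu : (0 < size mu)%N).
Hypothesis ssyt : is_ssyt n mu s.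
Let K := (ncols mu).-1.
Let colsK : ncols mu = K.+1. Proof. by rewrite prednK // ncols_gt0. Qed.

Lemma fv_ord (T : box mu n) (a : 'I_(size mu)) (b : 'I_(ncols mu)) : fv T a.+1 b.+1 = T (a, b).
Proof. by rewrite /fv /= !valK. Qed.

Let sort_columns (T : box mu n) : bool :=
  normalized T && all (fun j => sort leq (column mu (fv T) j) == column mu s j) (cols mu).

Let columns_of (T : box mu n) : seq (seq nat) := [seq column mu (fv T) j | j <- cols mu].

Let nth_columns_of T b : (b <= K)%N -> nth [::] (columns_of T) b = column mu (fv T) b.+1.
Proof.
by move=> bK; rewrite (nth_map 0%N) ?size_iota ?colsK // nth_iota ?colsK // add1n.
Qed.

Let perm_column_sort C j : (0 < j)%N ->
  (sort leq C == column mu s j) = perm_eq C (column mu s j).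
Proof.
move=> j0; have sS : sorted leq (column mu s j).
  by have := ssyt_column_sorted smu nmu ssyt j0; rewrite ltn_sorted_uniq_leq => /andP[].
rewrite -[in LHS](sorted_sort leq_trans sS).
by apply/eqP/(perm_sortP leq_total leq_trans anti_leq).
Qed.

(** Without [inF] the columns can be ordered independently, and being normalized makes a filling
    determined by its columns. The condition [inF] returns through [chain_weight], which vanishes
    when it fails. *)
Lemma sum_sort_columns (R : nmodType) (G : seq (seq nat) -> R) :
  \sum_(T : box mu n | sort_columns T) G (columns_of T)
  = \sum_(X <- column_choices (fun k => column mu s (ncols mu - k)) K) G X.
Proof.
transitivity (\sum_(X <- [seq columns_of T | T <- enum [pred T | sort_columns T]]) G X).
  by rewrite big_map big_enum.
apply: perm_big; apply: uniq_perm.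
- rewrite map_inj_in_uniq ?enum_uniq // => T U; rewrite !mem_enum !inE.
  case/andP=> /forallP nT _ /andP[/forallP nU _] eqC.
  apply/ffunP => -[a b]; apply/val_inj => /=.
  have := nT (a, b); have := nU (a, b) => /=; case: (boolP (cell _ _ _)) => /= c.
    move=> _ _; have bK : (b <= K)%N by rewrite -ltnS -colsK.
    have := congr1 (fun X => nth 0%N (nth [::] X b) a) eqC.
    have ac : (a < colLen mu b.+1)%N by move: c; rewrite cellE.
    by rewrite !nth_columns_of // !nth_column // !fv_ord.
  by move=> /eqP-> /eqP->.
- exact: column_choices_uniq.
move=> X; rewrite mem_column_choices; apply/mapP/andP => [[T]|[/eqP zX /allP pX]].
  rewrite mem_enum inE => /andP[_ /allP aT] ->; rewrite size_map size_iota colsK; split=> //.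
  apply/allP => i; rewrite mem_iota add0n => /andP[_ iK].
  rewrite nth_columns_of //; have -> : (K.+1 - (K - i) = i.+1)%N by lia.
  rewrite -perm_column_sort //; apply: aT.
  by rewrite mem_cols // colsK.
have {}pX b : (b <= K)%N -> perm_eq (nth [::] X b) (column mu s b.+1).
  move=> bK; have := pX b; rewrite mem_iota add0n /= ltnS => /(_ bK).
  by rewrite colsK; have -> : (K.+1 - (K - b) = b.+1)%N by lia.
have bX b i : (b <= K)%N -> (i < colLen mu b.+1)%N -> (nth 0 (nth [::] X b) i <= n)%N.
  move=> bK iC; have : nth 0%N (nth [::] X b) i \in column mu s b.+1.
    by rewrite -(perm_mem (pX _ bK)) mem_nth // (perm_size (pX _ bK)) size_column.
  by move/(allP (ssyt_column_bound smu nmu ssyt (ltn0Sn b))) => /andP[].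
(* The value 0 outside [mu] makes [T] normalized, and [bX] ensures that [inord] does not alter the
   entries. *)
pose T : box mu n := [ffun x : 'I_(size mu) * 'I_(ncols mu) =>
  inord (if cell mu x.1.+1 x.2.+1 then nth 0%N (nth [::] X x.2) x.1 else 0%N)].
have colT b : (b <= K)%N -> column mu (fv T) b.+1 = nth [::] X b.
  move=> bK; have zb : size (nth [::] X b) = colLen mu b.+1.
    by rewrite (perm_size (pX _ bK)) size_column.
  apply: (@eq_from_nth _ 0%N); rewrite size_column ?zb // => i iC; rewrite nth_column //.
  have iN : (i < size mu)%N by apply: leq_trans iC (colLen_size _ _).
  have bN : (b < ncols mu)%N by rewrite colsK.
  rewrite (fv_ord T (Ordinal iN) (Ordinal bN)) ffunE /= cellE // iC.
  by rewrite inordK // ltnS bX.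
exists T; last first.
  apply: (@eq_from_nth _ [::]); first by rewrite zX size_map size_iota colsK.
  by move=> b; rewrite zX ltnS => bK; rewrite nth_columns_of // colT.
rewrite mem_enum inE; apply/andP; split.
  by apply/forallP => x; apply/implyP => c; rewrite ffunE (negbTE c) inordK.
apply/allP => -[|b]; rewrite mem_cols // colsK ltnS => bK.
by rewrite perm_column_sort // colT // pX.
Qed.

Lemma sum_in_sort_inv (R : idomainType) (t : R) :
  \sum_(T : box mu n | in_sort_inv s T)
     (-1) ^+ ell (column mu (fv T) 1) * t ^+ inv_stat mu (fv T) * (1 - t) ^+ des_stat mu (fv T)
  = \sum_(X <- column_choices (fun k => column mu s (ncols mu - k)) K)
      (-1) ^+ ell (head [::] X) * chain_weight t X.
Proof.
rewrite -sum_sort_columns (eq_bigl (fun T => sort_columns T && inF n mu (fv T))); last first.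
  by move=> T; rewrite /in_sort_inv /sort_columns -andbA; congr (_ && _); rewrite andbC.
rewrite big_mkcondr; apply: eq_bigr => T /andP[_ /allP aT].
rewrite (chain_weight_columns smu pmu nmu t (n := n)); last first.
  move=> j jC; have := aT j; rewrite mem_cols // => /(_ jC).
  have /andP[j0 _] := jC; rewrite perm_column_sort // => pj.
  rewrite (perm_uniq pj) (perm_all _ pj); split; last exact: ssyt_column_bound.
  by have := ssyt_column_sorted smu nmu ssyt j0; rewrite ltn_sorted_uniq_leq => /andP[].
have -> : head [::] (columns_of T) = column mu (fv T) 1.
  by rewrite /columns_of /cols colsK.
by case: ifP => _; rewrite ?mulr0 // mulrA.
Qed.

Lemma sum_in_sort_inv_root (R : idomainType) (t : R) : 1 - t != 0 ->
  \sum_(T : box mu n | in_sort_inv s T)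
     (-1) ^+ ell (column mu (fv T) 1) * t ^+ inv_stat mu (fv T) * (1 - t) ^+ des_stat mu (fv T)
  = \prod_(k < K) hat_factor t (rootcol mu s k.+1) (rootcol mu s k.+2).
Proof.
move=> t1; rewrite sum_in_sort_inv.
have pos k : (k <= K)%N -> (0 < ncols mu - k)%N by rewrite colsK subn_gt0.
have prev k : (k < K)%N -> (ncols mu - k = (ncols mu - k.+1).+1)%N.
  by move=> kK; rewrite colsK; lia.
(* The virtual entry is [n.+1], just above all entries of [s]. *)
have [|||||||_ ->] := @chain_sum R t t1 (fun k => column mu s (ncols mu - k))
  (rootcol_aux mu s) K n.+1 _ _ _ _ _ _ _ K (leqnn K).
- by move=> k kK; apply: (ssyt_column_sorted smu nmu ssyt (pos _ kK)).
- move=> k kK; apply: sub_all (ssyt_column_bound smu nmu ssyt (pos _ kK)) => x.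
  by case/andP=> _; rewrite /= ltnS.
- move=> k kK; rewrite !size_column (prev _ kK).
  exact: colLenS.
- move=> k i kK; rewrite size_column (prev _ kK); apply: (ssyt_column_leq smu nmu ssyt).
  exact: pos.
- by rewrite subn0 size_column colLen_ncols.
- by rewrite /= subn0.
- by [].
(* [chain_sum] numbers the columns from the right, the claim from the left. *)
rewrite (reindex_inj rev_ord_inj); apply: eq_bigr => k _.
rewrite [rev_ord k : nat]/= /rootcol colsK !subSS.
by have -> : (K - k = (K - k.+1).+1)%N by rewrite -subSn ?ltn_ord // subSS.
Qed.

End Fillings.

Theorem theorem4p1 (n : nat) (lam : seq nat) (s : nat -> nat -> nat) :
  (2 <= n)%N -> size lam = n.-1 -> sorted geq lam ->
  is_ssyt n (addrho n lam) s ->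
  let mu := addrho n lam in
  let m := ncols mu in
  \sum_(T : box mu n | in_sort_inv s T)
     ((-1) ^+ ell (column mu (fv T) 1) * 'X ^+ inv_stat mu (fv T)
        * (1 - 'X) ^+ des_stat mu (fv T) : {poly int})
  = if all (fun i => nonoverlap (rootcol mu s i.-1) (rootcol mu s i)) (iota 2 m.-1)
    then (- 'X) ^+ (\sum_(2 <= i < m.+1)
                      (Ncheck (rootcol mu s i.-1) (rootcol mu s i)
                       + Nhat (rootcol mu s i.-1) (rootcol mu s i)))%N
         * (1 - 'X) ^+ (\sum_(2 <= i < m.+1) pstat (rootcol mu s i.-1) (rootcol mu s i))%N
    else 0.
Proof.
move=> n2 zl sl ssyt mu m.
have [smu pmu] := addrho_shape zl sl.
have nmu : (0 < size mu)%N by rewrite size_map size_iota; lia.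
have t1 : 1 - 'X != 0 :> {poly int}.
  by apply/eqP => /(congr1 (fun p => p.[0])); rewrite !hornerE => /eqP.
rewrite (sum_in_sort_inv_root smu pmu nmu ssyt t1) -/mu -/m.
have shift (f : nat -> nat) : (\sum_(2 <= i < m.+1) f i = \sum_(k < m.-1) f k.+2)%N.
  rewrite -[2%N]add0n big_addn big_mkord; have -> : (m.+1 - 2 = m.-1)%N by lia.
  by apply: eq_bigr => k _; rewrite addn2.
rewrite !shift -!prodrXr -big_split /=.
pose good k := nonoverlap (rootcol mu s k.+1) (rootcol mu s k.+2).
have -> : all (fun i => nonoverlap (rootcol mu s i.-1) (rootcol mu s i)) (iota 2 m.-1)
        = [forall k : 'I_m.-1, good k].
  rewrite (iotaDl 2 0) all_map; apply/allP/forallP => [h k|h k].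
    by have := h (val k); rewrite mem_iota add0n /= ltn_ord => /(_ isT).
  by rewrite mem_iota add0n /= => kK; apply: (h (Ordinal kK)).
(* A single overlapping pair of columns annihilates the product, which gives the second case of the
   claim. *)
by rewrite -(@prod_if _ m.-1 good (fun k =>
  (- 'X) ^+ (Ncheck (rootcol mu s k.+1) (rootcol mu s k.+2) + Nhat (rootcol mu s k.+1) (rootcol mu s k.+2))
  * (1 - 'X) ^+ pstat (rootcol mu s k.+1) (rootcol mu s k.+2))).
Qed.
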